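(* Let $(R,\mathfrak m)$ be a Noetherian local ring that is a hypersurface with $\mathfrak m^2\ne0$. Then $\operatorname{cs}(R)=\mu(\mathfrak m)$. Further, if $e(R)\le2$, then $\operatorname{ms}(R)=\dim R$; otherwise, $\operatorname{ms}(R)=\mu(\mathfrak m)$.
   Context: Rings are commutative with unity. A Noetherian local ring $(R,\mathfrak m)$ is a hypersurface if it is Cohen-Macaulay with $\mu(\mathfrak m)\le\dim R+1$ (equivalently, its completion is a regular local ring modulo a principal proper ideal; regular local rings are included). $e(R)$ denotes the Hilbert-Samuel multiplicity of $R$ with respect to $\mathfrak m$. With $k=R/\mathfrak m$, $\mu(I)=\dim_k(I/\mathfrak mI)$ is the minimal number of generators of an ideal $I$. Define $$\operatorname{cs}(R)=\min\{\mu(I): I\subseteq\mathfrak m \text{ an ideal with } I^2=\mathfrak m^2\},\qquad \operatorname{ms}(R)=\min\{\mu(I): I\subseteq \mathfrak m \text{ an ideal with } I\supseteq \mathfrak m^2\}.$$ *)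

(* Defs.v *)
From HB Require Import structures.
From mathcomp Require Import all_boot all_order all_algebra.
From mathcomp Require Import boolp classical_sets.

Set Implicit Arguments.
Unset Strict Implicit.
Unset Printing Implicit Defensive.

Import Order.TTheory GRing.Theory Num.Theory.

Local Open Scope classical_set_scope.
Local Open Scope ring_scope.

(* [infimum 0 A] and [supremum 0 A] over nat are the minimum and the maximum
   of [A] when [A] is nonempty (resp. nonempty and bounded), and 0 otherwise.
   For the uses below, this default value is never reached in a Noetherian
   local ring. *)

Section Ideals.
Context {R : comNzRingType}.
Implicit Types (I J P : set R) (s : seq R) (n : nat).

(* Ideals (the unit ideal included) are the submodules of the regular module;
   [idealr_closed], in contrast, only holds of proper ideals. *)
Definition ideal I : Prop := submod_closed ([in I] : {pred R^o}).

Definition prime_ideal P : Prop :=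
  idealr_closed [in P] /\ prime_idealr_closed [in P].

Definition maximal_ideal P : Prop :=
  idealr_closed [in P] /\
  forall J, idealr_closed [in J] -> P `<=` J -> J = P.

Definition ideal_gen (A : set R) : set R := smallest ideal A.

Definition ideal_mul I J : set R :=
  ideal_gen [set x * y | x in I & y in J].

Definition ideal_exp I n : set R := iter n (ideal_mul I) setT.

Definition mu I : nat :=
  infimum 0%N [set size s | s in [set s | ideal_gen [set` s] = I]].

(* [n] is the number of strict inclusions in the chain. *)
Definition chain_lengths (C : set (set R)) : set nat :=
  [set n | exists J : nat -> set R,
     (forall i, (i <= n)%N -> C (J i)) /\
     (forall i, (i < n)%N -> J i `<` J i.+1)].

(* The length of the R-module R/I, whose submodules are the J/I with J an
   ideal containing I. *)
Definition quotient_length I : nat :=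
  supremum 0%N (chain_lengths [set J | ideal J /\ I `<=` J]).

Definition regular_seq s : Prop :=
  ideal_gen [set` s] <> setT /\
  forall i, (i < size s)%N -> forall a,
    ideal_gen [set` take i s] (s`_i * a) -> ideal_gen [set` take i s] a.

End Ideals.

Definition noetherian (R : comNzRingType) : Prop :=
  forall I : set R, ideal I -> exists s : seq R, ideal_gen [set` s] = I.

Definition krull_dim (R : comNzRingType) : nat :=
  supremum 0%N (chain_lengths (@prime_ideal R)).

Section LocalRings.
Context {R : comNzRingType}.
Implicit Types (m : set R).

Definition local_ring m : Prop :=
  maximal_ideal m /\ forall P, maximal_ideal P -> P = m.

Definition depth m : nat :=
  supremum 0%N
    [set size s | s in [set s | regular_seq s /\ [set` s] `<=` m]].

Definition cohen_macaulay m : Prop := depth m = krull_dim R.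

Definition hypersurface m : Prop :=
  cohen_macaulay m /\ (mu m <= krull_dim R + 1)%N.

Definition hilbert_samuel_poly m : {poly rat} :=
  xget 0 [set p : {poly rat} | exists N : nat, forall n : nat, (N <= n)%N ->
            p.[n%:R] = (quotient_length (ideal_exp m n))%:R].

(* The Hilbert-Samuel polynomial has degree [krull_dim R], so this is
   [(dim R)!] times its leading coefficient. *)
Definition multiplicity m : rat :=
  ((krull_dim R)`!)%:R * (hilbert_samuel_poly m)`_(krull_dim R).

Definition cs m : nat :=
  infimum 0%N [set mu I | I in
    [set I | [/\ ideal I, I `<=` m & ideal_exp I 2 = ideal_exp m 2]]].

Definition ms m : nat :=
  infimum 0%N [set mu I | I in
    [set I | [/\ ideal I, I `<=` m & ideal_exp m 2 `<=` I]]].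

End LocalRings.

(* Main.v *)
Require Import Defs.
From mathcomp Require Import all_boot all_order all_algebra.
From mathcomp Require Import boolp classical_sets.
From mathcomp Require Import zify.
From Stdlib Require Import Ring.

(** Let d be the dimension of R and n = mu m. A Cohen-Macaulay local ring has a
    regular sequence of length d in m, and the ideal it generates contains a
    power of m. Depth theory then shows that every ideal between a power of m
    and m needs at least d generators ([parameters_ge_depth]): otherwise some
    depth would be left modulo these generators, and so would a nonzerodivisor
    that is nilpotent. In particular n is d or d + 1, and if n = d then
    cs = ms = n.

    Suppose that n = d + 1 and let g be minimal generators of m. The monomials
    in g cannot be independent in all degrees, because the length of R/m^N
    grows too slowly ([exists_relation]); let f >= 2 be the least degree of a
    nontrivial relation. The heart of the proof is [hilbert_function]: the
    Hilbert function of R is that of a hypersurface of degree f in n variables,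
    that is, m^i/m^(i+1) has as many basis elements as there are monomials of
    degree i where a given variable has exponent less than f.
    This would be clear if R were a quotient of a regular ring by one
    element of order f; the argument below replaces such a presentation by
    depth. After a finite free base change, the leading form of the relation
    takes a unit value at some point ([inverting_extension]). The d linear forms
    vanishing at this point generate a reduction q of m ([point_reduction]).
    By the exchange property of nonzerodivisors ([depth_exchange]), q is
    generated by a regular sequence ([regular_generators]), so its powers are
    as independent as possible ([quasi_regular]). The remaining generator y of
    m has its powers y^j, j < f, independent modulo q, as there is no relation
    of smaller degree ([powers_indep]), and y^f comes back into q m^(f-1).
    Comparing powers of m with powers of q ([mexp_qexp]) yields the basis
    ([staircase_indep]).

    Summing the Hilbert function gives the Hilbert-Samuel polynomial, so the
    multiplicity is f ([multiplicity_eq]), and mu (m^2) is n(n+1)/2, minus 1 if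
    f = 2. If I^2 = m^2 for an ideal I with d generators, then m^2 has at most
    d(d+1)/2 generators, which forces d = 0, I = 0 and m^2 = 0; hence cs = n.
    If f = 2, the leading form is a quadratic form, which has a nonzero value
    at a rational point over any residue field ([quadric_point]); the reduction
    q attached to this point has d generators and contains m^2, so ms = d.
    If f > 2, the quadratic monomials are independent, and an ideal between m^2
    and m needs n generators ([mu_over_square]). *)

Set Implicit Arguments.
Unset Strict Implicit.
Unset Printing Implicit Defensive.

Import Order.TTheory GRing.Theory Num.Theory.

Local Open Scope classical_set_scope.
Local Open Scope ring_scope.

(** * Normalization of ring expressions *)

Section RingStructure.
Variable R : comNzRingType.
(** In a goal, the operations of an abstract ring occur through several joins of
    structures. These copies have one carrier, over which [ring] is declared. *)
Definition rsort : Type := GRing.ComNzRing.sort R.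
Definition radd (x y : rsort) : rsort := (x : R) + y.
Definition rmul (x y : rsort) : rsort := (x : R) * y.
Definition ropp (x : rsort) : rsort := - (x : R).
Definition rsub (x y : rsort) : rsort := (x : R) - y.
Definition rzero : rsort := 0 : R.
Definition rone : rsort := 1 : R.

Lemma ring_axioms : ring_theory rzero rone radd rmul rsub ropp eq.
Proof.
by split; [exact: add0r|exact: addrC|exact: addrA|exact: mul1r|exact: mulrC
  |exact: mulrA|exact: mulrDl| |exact: subrr].
Qed.

(** [ring] reads the carrier off the left-hand side, which may be a bare variable;
    a leading [radd rzero] fixes it. *)
Lemma radd0_inj (x y : rsort) : radd rzero x = radd rzero y -> x = y.
Proof. by rewrite /radd /rzero !add0r. Qed.

End RingStructure.

Ltac cring R :=
  match goal with |- @eq _ ?a ?b => apply (@radd0_inj R a b) end;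
  repeat match goal with
  | |- context [@GRing.add ?T ?a ?b] =>
      change (@GRing.add T a b) with (@radd R a b)
  | |- context [@GRing.mul ?T ?a ?b] =>
      change (@GRing.mul T a b) with (@rmul R a b)
  | |- context [@GRing.opp ?T ?a] => change (@GRing.opp T a) with (@ropp R a)
  | |- context [@GRing.zero ?T] => change (@GRing.zero T) with (@rzero R)
  | |- context [@GRing.one ?T] => change (@GRing.one T) with (@rone R)
  end;
  ring.

Notation gen s := (ideal_gen [set` s]).

(** * Ideals and their generators *)

Section Ideals.
Context {R : comNzRingType}.
Add Ring ring1 : (ring_axioms R).
Implicit Types (I J K B P : set R) (s t : seq R) (x y u v : R) (c : nat -> R).

Lemma idealP I : ideal I <->
  [/\ I 0, forall x y, I x -> I y -> I (x + y) & forall r x, I x -> I (r * x)].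
Proof.
split=> [[I0 Ilin]|[I0 ID IM]].
  move: I0; rewrite in_setE => I0; split=> // [x y Ix Iy|r x Ix].
    by have := Ilin 1 x y; rewrite !in_setE scale1r; apply.
  by have := Ilin r x 0; rewrite !in_setE addr0; apply.
split; first by rewrite in_setE.
by move=> a u v; rewrite !in_setE => Iu Iv; apply: ID => //; apply: IM.
Qed.

Section Closure.
Variables (I : set R) (idI : ideal I).

Lemma ideal0 : I 0. Proof. by case/idealP: idI. Qed.

Lemma idealD x y : I x -> I y -> I (x + y).
Proof. by case/idealP: idI => _ + _; apply. Qed.

Lemma idealM r x : I x -> I (r * x).
Proof. by case/idealP: idI => _ _; apply. Qed.

Lemma idealMr r x : I x -> I (x * r).
Proof. by rewrite mulrC; apply: idealM. Qed.

Lemma idealN x : I x -> I (- x).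
Proof. by rewrite -mulN1r; apply: idealM. Qed.

Lemma idealB x y : I x -> I y -> I (x - y).
Proof. by move=> Ix Iy; apply/idealD/idealN. Qed.

Lemma idealDr x y : I x -> I (y + x) -> I y.
Proof. by move=> Ix Iyx; rewrite -(addrK x y); apply: idealB. Qed.

Lemma ideal_sum (T : Type) (r : seq T) (Q : pred T) (F : T -> R) :
  (forall i, Q i -> I (F i)) -> I (\sum_(i <- r | Q i) F i).
Proof. by move=> IF; elim/big_ind: _ => //; [exact: ideal0|exact: idealD]. Qed.

End Closure.

Lemma ideal_setT : ideal [set: R]. Proof. by apply/idealP. Qed.

Lemma ideal_set0 : ideal [set (0 : R)].
Proof. by apply/idealP; split=> // [x y -> ->|r x ->]; rewrite ?addr0 ?mulr0. Qed.

Lemma ideal_ideal_gen (A : set R) : ideal (ideal_gen A).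
Proof.
apply/idealP; split.
- by move=> I [/ideal0].
- by move=> x y Gx Gy I [idI AI]; apply: idealD => //; [exact: Gx|exact: Gy].
- by move=> r x Gx I [idI AI]; apply: idealM => //; exact: Gx.
Qed.
Hint Resolve ideal_setT ideal_set0 ideal_ideal_gen : core.

Lemma ideal_mul_ideal I J : ideal (ideal_mul I J).
Proof. exact: ideal_ideal_gen. Qed.
Hint Resolve ideal_mul_ideal : core.

Lemma ideal_exp_ideal I n : ideal (ideal_exp I n).
Proof. by case: n => [|n]; [exact: ideal_setT|exact: ideal_mul_ideal]. Qed.
Hint Resolve ideal_exp_ideal : core.

Lemma ideal_gen_sub (A : set R) I : ideal I -> A `<=` I -> ideal_gen A `<=` I.
Proof. by move=> idI AI u; apply. Qed.

Lemma sub_ideal_gen (A : set R) : A `<=` ideal_gen A.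
Proof. by move=> u Au I [_ AI]; apply: AI. Qed.

Lemma ideal_mul_in I J x y : I x -> J y -> ideal_mul I J (x * y).
Proof. by move=> Ix Jy; apply: sub_ideal_gen; exists x => //; exists y. Qed.

Lemma ideal_mul_sub I J K : ideal K ->
  (forall x y, I x -> J y -> K (x * y)) -> ideal_mul I J `<=` K.
Proof.
move=> idK IJK; apply: ideal_gen_sub => // _ [x Ix [y Jy <-]].
exact: IJK.
Qed.

Lemma ideal_mulS I J I' J' :
  I `<=` I' -> J `<=` J' -> ideal_mul I J `<=` ideal_mul I' J'.
Proof.
move=> sI sJ; apply: ideal_mul_sub => // x y Ix Jy.
by apply: ideal_mul_in; [exact: sI|exact: sJ].
Qed.

Lemma ideal_mul_subr I J : ideal J -> ideal_mul I J `<=` J.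
Proof. by move=> idJ; apply: ideal_mul_sub => // x y _; apply: idealM. Qed.

Lemma ideal_mul_subl I J : ideal I -> ideal_mul I J `<=` I.
Proof. by move=> idI; apply: ideal_mul_sub => // x y Ix _; apply: idealMr. Qed.

Lemma ideal_mulC I J : ideal_mul I J = ideal_mul J I.
Proof.
by apply/seteqP; split; apply: ideal_mul_sub => // x y ? ?; rewrite mulrC;
  apply: ideal_mul_in.
Qed.

Lemma ideal_mulA I J K :
  ideal_mul I (ideal_mul J K) = ideal_mul (ideal_mul I J) K.
Proof.
have colon x L : ideal L -> ideal [set y | L (x * y)].
  move=> idL; apply/idealP; split=> /= [|y z|r y].
  - by rewrite mulr0; apply: ideal0.
  - by rewrite mulrDr; apply: idealD.
  - by rewrite mulrCA; apply: idealM.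
apply/seteqP; split; apply: ideal_mul_sub => // x y.
  move=> Ix; move: y.
  suff : ideal_mul J K `<=` [set y | ideal_mul (ideal_mul I J) K (x * y)] by [].
  apply: ideal_mul_sub => [|y z Jy Kz] /=; first exact: colon.
  by rewrite mulrA; do 2!apply: ideal_mul_in => //.
move=> + Ky; move: x.
suff : ideal_mul I J `<=` [set x | ideal_mul I (ideal_mul J K) (y * x)].
  by move=> + x IJx => /(_ x IJx); rewrite /= mulrC.
apply: ideal_mul_sub => [|x z Ix Jz] /=; first exact: colon.
by rewrite mulrC -mulrA; do 2!apply: ideal_mul_in => //.
Qed.

Lemma ideal_mulT I : ideal I -> ideal_mul I setT = I.
Proof.
move=> idI; apply/seteqP; split; first exact: ideal_mul_subl.
by move=> x Ix; rewrite -(mulr1 x); apply: ideal_mul_in.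
Qed.

Lemma ideal_exp1 I : ideal I -> ideal_exp I 1 = I.
Proof. exact: ideal_mulT. Qed.

Lemma ideal_expS I n : ideal_exp I n.+1 = ideal_mul I (ideal_exp I n).
Proof. by []. Qed.

Lemma ideal_expD I a b : ideal I ->
  ideal_exp I (a + b) = ideal_mul (ideal_exp I a) (ideal_exp I b).
Proof.
move=> idI; elim: a => [|a IHa]; last by rewrite addSn /= IHa ideal_mulA.
by rewrite add0n ideal_mulC ideal_mulT.
Qed.

Lemma ideal_exp_le I a b : ideal I -> (a <= b)%N ->
  ideal_exp I b `<=` ideal_exp I a.
Proof.
by move=> idI /subnKC <-; rewrite ideal_expD //; apply: ideal_mul_subl.
Qed.

Lemma ideal_exp_in I x n : I x -> ideal_exp I n (x ^+ n).
Proof.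
by move=> Ix; elim: n => // n IHn; rewrite exprS; apply: ideal_mul_in.
Qed.

Lemma ideal_expM I a x b y : ideal I ->
  ideal_exp I a x -> ideal_exp I b y -> ideal_exp I (a + b) (x * y).
Proof. by move=> idI Ix Iy; rewrite ideal_expD //; apply: ideal_mul_in. Qed.

Lemma ideal_exp_sub I J n : I `<=` J -> ideal_exp I n `<=` ideal_exp J n.
Proof. by move=> IJ; elim: n => //= n IHn; apply: ideal_mulS. Qed.

(** Coefficients are functions on nat, so that a combination of [s ++ t] splits by
    a shift of the argument. *)
Definition lincomb c s : R := \sum_(i < size s) c i * s`_i.

Lemma lincomb_nil c : lincomb c [::] = 0. Proof. by rewrite /lincomb big_ord0. Qed.

Lemma lincomb_cons c x s : lincomb c (x :: s) = c 0%N * x + lincomb (c \o S) s.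
Proof. by rewrite /lincomb /= big_ord_recl. Qed.

Lemma lincomb_cat c s t : lincomb c (s ++ t) = lincomb c s + lincomb (fun i => c (size s + i)%N) t.
Proof.
elim: s c => [|x s IHs] c /=; first by rewrite lincomb_nil add0r.
by rewrite !lincomb_cons IHs addrA.
Qed.

Lemma lincomb_map c a s : lincomb c [seq a * x | x <- s] = a * lincomb c s.
Proof.
elim: s c => [|x s IHs] c /=; rewrite ?lincomb_nil ?mulr0 // !lincomb_cons IHs; cring R.
Qed.

Lemma eq_lincomb c c' s : (forall i, (i < size s)%N -> c i = c' i) -> lincomb c s = lincomb c' s.
Proof. by move=> E; apply: eq_bigr => i _; rewrite E. Qed.

Lemma lincombD c c' s : lincomb (fun i => c i + c' i) s = lincomb c s + lincomb c' s.
Proof. by rewrite /lincomb -big_split; apply: eq_bigr => i _; rewrite mulrDl. Qed.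

Lemma lincombB c c' s : lincomb (fun i => c i - c' i) s = lincomb c s - lincomb c' s.
Proof. by rewrite /lincomb -sumrB; apply: eq_bigr => i _; rewrite mulrBl. Qed.

Lemma lincombZ a c s : lincomb (fun i => a * c i) s = a * lincomb c s.
Proof. by rewrite /lincomb mulr_sumr; apply: eq_bigr => i _; rewrite mulrA. Qed.

Lemma lincomb0 s : lincomb (fun=> 0) s = 0.
Proof. by rewrite /lincomb big1 // => i _; rewrite mul0r. Qed.

Lemma lincomb_ideal I c s : ideal I ->
  (forall i, (i < size s)%N -> I (s`_i)) -> I (lincomb c s).
Proof. by move=> idI Is; apply: ideal_sum => // i _; apply: idealM => //; apply: Is. Qed.

Lemma lincomb_ideal_mul I J c s :
  (forall i, (i < size s)%N -> I (c i)) -> (forall i, (i < size s)%N -> J s`_i) ->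
  ideal_mul I J (lincomb c s).
Proof.
by move=> Ic Is; apply: ideal_sum => // i _; apply: ideal_mul_in; [apply: Ic|apply: Is].
Qed.

Lemma lincomb_ideal_coef I c s : ideal I ->
  (forall i, (i < size s)%N -> I (c i)) -> I (lincomb c s).
Proof. by move=> idI Is; apply: ideal_sum => // i _; apply: idealMr => //; apply: Is. Qed.

Lemma lincomb_delta s i : (i < size s)%N -> lincomb (fun j => (j == i)%:R) s = s`_i.
Proof.
move=> lt_is; rewrite /lincomb (bigD1 (Ordinal lt_is)) //= eqxx mul1r big1 ?addr0 //.
by move=> j; rewrite -val_eqE /= => /negPf ->; rewrite mul0r.
Qed.

Lemma genP s u : gen s u <-> exists c, u = lincomb c s.
Proof.
split; last first.
  move=> [c ->]; apply: lincomb_ideal => // i lt_is.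
  by apply: sub_ideal_gen => /=; apply: mem_nth.
suff : gen s `<=` [set u | exists c, u = lincomb c s] by apply.
apply: ideal_gen_sub; last first.
  move=> x /= xs; exists (fun j => (j == index x s)%:R).
  by rewrite lincomb_delta ?index_mem // nth_index.
apply/idealP; split.
- by exists (fun=> 0); rewrite lincomb0.
- by move=> _ _ [c ->] [c' ->]; exists (fun i => c i + c' i); rewrite lincombD.
- by move=> r _ [c ->]; exists (fun i => r * c i); rewrite lincombZ.
Qed.

Lemma gen_lincomb c s : gen s (lincomb c s). Proof. by apply/genP; exists c. Qed.

Lemma gen_in x s : x \in s -> gen s x.
Proof. by move=> xs; apply: sub_ideal_gen. Qed.

Lemma gen_nth s i : gen s s`_i.
Proof.
have [lt_is|le_si] := ltnP i (size s); first by apply: gen_in; apply: mem_nth.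
by rewrite nth_default //; apply: (ideal0 (ideal_ideal_gen _)).
Qed.

Lemma gen_sub s I : ideal I -> {in s, forall x, I x} -> gen s `<=` I.
Proof. by move=> idI sI; apply: ideal_gen_sub => // x xs; apply: sI. Qed.

Lemma gen_subl s t : {in s, forall x, gen t x} -> gen s `<=` gen t.
Proof. by move=> st; apply: gen_sub. Qed.

Lemma gen_nil : gen [::] = [set (0 : R)].
Proof.
apply/seteqP; split=> [u /genP[c ->]|u ->]; first by rewrite lincomb_nil.
exact: (ideal0 (ideal_ideal_gen _)).
Qed.

Lemma genS s t : {subset s <= t} -> gen s `<=` gen t.
Proof. by move=> st; apply: gen_subl => x /st /gen_in. Qed.

Lemma gen_cons_inP x s u :
  gen (x :: s) u <-> exists r v, gen s v /\ u = r * x + v.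
Proof.
split=> [/genP[c ->]|[r [v [gv ->]]]].
  by exists (c 0%N), (lincomb (c \o S) s); rewrite lincomb_cons; split=> //; apply: gen_lincomb.
apply: (idealD (ideal_ideal_gen _)); last first.
  by apply: genS gv => y ys; rewrite in_cons ys orbT.
by apply: (idealM (ideal_ideal_gen _)); apply: gen_in; rewrite mem_head.
Qed.

Definition ideal_addp B x : set R := [set u | exists b r, B b /\ u = b + r * x].

Lemma ideal_addp_ideal B x : ideal B -> ideal (ideal_addp B x).
Proof.
move=> idB; apply/idealP; split.
- by exists 0, 0; split; [exact: ideal0|rewrite mul0r addr0].
- move=> _ _ [b [r [Bb ->]]] [b' [r' [Bb' ->]]]; exists (b + b'), (r + r').
  by split; [exact: idealD|cring R].
- move=> a _ [b [r [Bb ->]]]; exists (a * b), (a * r).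
  by split; [exact: idealM|cring R].
Qed.

Lemma ideal_addp_sub B x : B `<=` ideal_addp B x.
Proof. by move=> b Bb; exists b, 0; rewrite mul0r addr0. Qed.

Lemma ideal_addp_in B x : ideal B -> ideal_addp B x x.
Proof. by move=> idB; exists 0, 1; rewrite mul1r add0r; split=> //; apply: ideal0. Qed.

Lemma ideal_addp_min B x I : ideal I -> B `<=` I -> I x -> ideal_addp B x `<=` I.
Proof.
move=> idI BI Ix _ [b [r [/BI Ib ->]]].
by apply: idealD => //; apply: idealM.
Qed.

Lemma ideal_addpC B x y : ideal_addp (ideal_addp B x) y = ideal_addp (ideal_addp B y) x.
Proof.
by apply/seteqP; split=> _ [_ [r [[b [r' [Bb ->]]] ->]]];
  [exists (b + r * y), r'|exists (b + r * x), r'];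
  (split; last by cring R); exists b, r.
Qed.

Definition ideal_addl B s := foldl ideal_addp B s.

Lemma ideal_addl_ideal B s : ideal B -> ideal (ideal_addl B s).
Proof. by elim: s B => //= x s IHs B idB; apply: IHs; exact: ideal_addp_ideal. Qed.

Lemma ideal_addlP B s u : ideal_addl B s u <-> exists b v, [/\ B b, gen s v & u = b + v].
Proof.
elim: s B u => [|x s IHs] B u /=.
  split=> [Bu|[b [v [Bb]]]]; last by rewrite gen_nil => -> ->; rewrite addr0.
  by exists u, 0; rewrite addr0; split=> //; apply: ideal0.
split=> [/IHs[_ [v [[b [r [Bb ->]]] gv ->]]]|[b [v [Bb /gen_cons_inP[r [w [gw ->]]] ->]]]].
  exists b, (r * x + v); split=> //; last by rewrite addrA.
  by apply/gen_cons_inP; exists r, v.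
by apply/IHs; exists (b + r * x), w; split; rewrite ?addrA //; exists b, r.
Qed.

Lemma ideal_addl0 s : ideal_addl [set (0 : R)] s = gen s.
Proof.
apply/seteqP; split=> u.
  by move/ideal_addlP=> [b [v [-> gv ->]]]; rewrite add0r.
by move=> gu; apply/ideal_addlP; exists 0, u; rewrite add0r.
Qed.

Lemma gen_cat_inP s t u :
  gen (s ++ t) u <-> exists v w, [/\ gen s v, gen t w & u = v + w].
Proof.
rewrite -ideal_addl0 /ideal_addl foldl_cat -!/(ideal_addl _ _) ideal_addl0; exact: ideal_addlP.
Qed.

Lemma gen_mul s t : ideal_mul (gen s) (gen t) = gen [seq x * y | x <- s, y <- t].
Proof.
apply/seteqP; split; last first.
  apply: gen_sub => // _ /allpairsP[[x y] /= [xs yt ->]].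
  by apply: ideal_mul_in; apply: gen_in.
apply: ideal_mul_sub => // _ _ /genP[c ->] /genP[c' ->].
rewrite /lincomb mulr_suml; apply: (ideal_sum (ideal_ideal_gen _)) => i _; rewrite mulr_sumr.
apply: (ideal_sum (ideal_ideal_gen _)) => j _; rewrite mulrACA.
apply: (idealM (ideal_ideal_gen _)); apply: gen_in.
by apply: allpairs_f; apply: mem_nth.
Qed.

Lemma primeP P : prime_ideal P <->
  [/\ ideal P, ~ P 1 & forall x y, P (x * y) -> P x \/ P y].
Proof.
split=> [[[P0 P1 PL] Ppr]|[idP P1 Ppr]].
  move: P0 P1; rewrite in_setE => P0; rewrite notin_setE => P1; split=> //.
    apply/idealP; split=> // [x y Px Py|r x Px].
      by have := PL 1 x y; rewrite !in_setE mul1r; apply.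
    by have := PL r x 0; rewrite !in_setE addr0; apply.
  by move=> x y Pxy; have := Ppr x y; rewrite !in_setE => /(_ Pxy) /orP[];
     rewrite in_setE; [left|right].
split; first split.
- by rewrite in_setE; apply: ideal0.
- by rewrite notin_setE.
- by move=> a u v; rewrite !in_setE => Pu Pv; apply: idealD => //; apply: idealM.
move=> x y; rewrite in_setE => /Ppr[] ?; apply/orP; [left|right]; exact/mem_set.
Qed.

Lemma maxidealP P : maximal_ideal P <->
  [/\ ideal P, ~ P 1 & forall J, ideal J -> ~ J 1 -> P `<=` J -> J = P].
Proof.
have E J : idealr_closed [in J] <-> ideal J /\ ~ J 1.
  split=> [[J0 J1 JL]|[idJ J1]].
    move: J0 J1; rewrite in_setE => J0; rewrite notin_setE => J1; split=> //.
    apply/idealP; split=> // [x y Px Py|r x Px].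
      by have := JL 1 x y; rewrite !in_setE mul1r; apply.
    by have := JL r x 0; rewrite !in_setE addr0; apply.
  split.
  - by rewrite in_setE; apply: ideal0.
  - by rewrite notin_setE.
  - by move=> a u v; rewrite !in_setE => Pu Pv; apply: idealD => //; apply: idealM.
rewrite /maximal_ideal E; split=> [[[idP P1] mP]|[idP P1 mP]].
  by split=> // J idJ J1; apply: mP; apply/E.
by split=> // J /E[]; apply: mP.
Qed.

End Ideals.
#[export] Hint Resolve ideal_setT ideal_set0 ideal_ideal_gen ideal_mul_ideal ideal_exp_ideal
  ideal_addp_ideal ideal_addl_ideal : core.

(** * Noetherian rings, associated primes and prime avoidance *)

Section Noetherian.
Context {R : comNzRingType}.
Add Ring ring2 : (ring_axioms R).
Implicit Types (I J K B P Q : set R) (s : seq R) (x y z u v t : R) (c : nat -> R).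

(** A family without maximal element contains a strictly increasing sequence of
    ideals; finitely many elements generate its union, and they all belong to one
    of its terms. *)
Lemma noetherian_max (C : set (set R)) : noetherian R ->
  (forall I, C I -> ideal I) -> C !=set0 ->
  exists2 I, C I & forall J, C J -> I `<=` J -> J `<=` I.
Proof.
move=> noeth idC [I0 CI0]; apply: contrapT => nomax.
have next I : exists J, C I -> [/\ C J, I `<=` J & ~ (J `<=` I)].
  have [CI|nCI] := pselect (C I); last by exists I.
  apply: contrapT => nJ; apply: nomax; exists I => // J CJ IJ.
  by apply: contrapT => nJI; apply: nJ; exists J.
have [f fP] := choice next; pose A k := iter k f I0.
have CA k : C (A k) by elim: k => //= k /fP[].
have Amono k l : (k <= l)%N -> A k `<=` A l.
  move=> /subnKC <-; elim: (l - k)%N => [|j IHj]; first by rewrite addn0.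
  by rewrite addnS; apply: (subset_trans IHj); case: (fP _ (CA (k + j)%N)).
pose U : set R := [set u | exists k, A k u].
have idU : ideal U.
  apply/idealP; split.
  - by exists 0%N; apply: (ideal0 (idC _ (CA _))).
  - move=> x y [k Akx] [l Aly]; exists (maxn k l).
    apply: (idealD (idC _ (CA _))); [apply: (Amono k)|apply: (Amono l)] => //.
      exact: leq_maxl.
    exact: leq_maxr.
  - by move=> r x [k Akx]; exists k; apply: (idealM (idC _ (CA _))).
have [s sU] := noeth U idU.
have [N sN] : exists N, {in s, forall x, A N x}.
  have : {in s, forall x, U x} by move=> x xs; rewrite -sU; apply: gen_in.
  elim: (s) => [|x t IHt] tU; first by exists 0%N.
  have [|N tN] := IHt; first by move=> y yt; apply: tU; rewrite in_cons yt orbT.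
  have [k Akx] := tU x (mem_head _ _).
  exists (maxn k N) => y; rewrite in_cons => /orP[/eqP ->|/tN].
    exact: (Amono k) (leq_maxl _ _) _ Akx.
  exact: Amono (leq_maxr _ _) _.
have UN : U `<=` A N by rewrite -sU; apply: gen_sub => //; apply: idC.
have [_ _] := fP _ (CA N); apply=> u Au; apply: UN.
by exists N.+1.
Qed.

(** An ideal P maximal among those that contain B and miss T is prime: if x and y
    are outside P, then P + (x) and P + (y) meet T, hence so does P + (xy). *)
Lemma exists_prime (T : set R) B : noetherian R -> ideal B ->
  T 1 -> (forall x y, T x -> T y -> T (x * y)) -> (forall x, T x -> ~ B x) ->
  exists P, [/\ prime_ideal P, B `<=` P & forall x, T x -> ~ P x].
Proof.
move=> noeth idB T1 TM TB.
have [||P [idP BP TP] maxP] := @noetherian_max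
    [set P | [/\ ideal P, B `<=` P & forall x, T x -> ~ P x]] noeth.
- by move=> I [].
- by exists B; split.
exists P; split=> //; apply/primeP; split=> [//||x y Pxy]; first exact: TP.
have meet z : ~ P z -> exists t p r, [/\ T t, P p & t = p + r * z].
  move=> nPz; apply: contrapT => no; apply: nPz.
  apply: (maxP (ideal_addp P z)); [split|exact: ideal_addp_sub|exact: ideal_addp_in].
  - exact: ideal_addp_ideal.
  - by apply: subset_trans BP _; apply: ideal_addp_sub.
  - by move=> t Tt [p [r [Pp tE]]]; apply: no; exists t, p, r.
apply: contrapT => /not_orP[/meet[t [p [r [Tt Pp tE]]]]].
move=> /meet[t' [p' [r' [Tt' Pp' tE']]]].
apply: (TP (t * t')); first exact: TM.
have -> : t * t' = p * t' + r * x * p' + r * r' * (x * y).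
  by rewrite tE'; rewrite [in LHS]tE; cring R.
apply: (idealD idP); last exact: (idealM idP).
by apply: (idealD idP); [exact: (idealMr idP)|exact: (idealM idP)].
Qed.

(** The rings obtained below by base change are not local, but the extension of
    the maximal ideal remains in the Jacobson radical; Nakayama's lemma and the
    depth theory are developed under this weaker condition. *)
Definition in_jacobson (m : set R) := ideal m /\ forall x, m x -> exists y, (1 + x) * y = 1.

Definition ideal_add I J : set R := [set u | exists x y, [/\ I x, J y & u = x + y]].

Lemma ideal_add_ideal I J : ideal I -> ideal J -> ideal (ideal_add I J).
Proof.
move=> idI idJ; apply/idealP; split.
- exists 0, 0; rewrite addr0.
  by split=> //; [exact: (ideal0 idI)|exact: (ideal0 idJ)].
- move=> _ _ [u [v [Iu Jv ->]]] [u' [v' [Iu' Jv' ->]]]; exists (u + u'), (v + v').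
  by split; [exact: (idealD idI)|exact: (idealD idJ)|cring R].
- move=> r _ [u [v [Iu Jv ->]]]; exists (r * u), (r * v).
  by split; [exact: (idealM idI)|exact: (idealM idJ)|cring R].
Qed.

Lemma ideal_mul_genP I s u : ideal I ->
  ideal_mul I (gen s) u <->
  exists c, (forall i, (i < size s)%N -> I (c i)) /\ u = lincomb c s.
Proof.
move=> idI; split=> [|[c [Ic ->]]]; last first.
  by apply: lincomb_ideal_mul => // i _; apply: gen_nth.
suff : ideal_mul I (gen s) `<=`
    [set u | exists c, (forall i, (i < size s)%N -> I (c i)) /\ u = lincomb c s] by apply.
apply: ideal_mul_sub.
  apply/idealP; split.
  - by exists (fun=> 0); split=> [i _|]; [exact: (ideal0 idI)|rewrite lincomb0].
  - move=> _ _ [c [Ic ->]] [c' [Ic' ->]]; exists (fun i => c i + c' i).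
    by split=> [i ltis|]; [apply: (idealD idI); [apply: Ic|apply: Ic']|rewrite lincombD].
  - move=> r _ [c [Ic ->]]; exists (fun i => r * c i).
    by split=> [i ltis|]; [apply: (idealM idI); apply: Ic|rewrite lincombZ].
move=> x y Ix /genP[c ->]; exists (fun i => x * c i).
by split=> [i _|]; [exact: (idealMr idI)|rewrite lincombZ].
Qed.

(** Induction on the generators: since 1 - c is a unit for c in m, an equation
    x = b + c x + w can be solved for x, which eliminates this generator. *)
Lemma nakayama m B s : in_jacobson m -> ideal B ->
  gen s `<=` ideal_add B (ideal_mul m (gen s)) -> gen s `<=` B.
Proof.
move=> [idm jm] idB; elim: s => [|x s IHs] sB.
  by rewrite gen_nil => _ ->; apply: ideal0.
have [b [_ [Bb /(ideal_mul_genP _ _ idm)[c [mc ->]] xE]]] : ideal_add B (ideal_mul m (gen (x :: s))) x.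
  by apply: sB; apply: gen_in; rewrite mem_head.
have [y yE] := jm (- c 0%N) (idealN idm (mc 0%N isT)).
have xE' : x = y * b + y * lincomb (c \o S) s.
  rewrite lincomb_cons in xE; transitivity ((1 + - c 0%N) * y * x).
    by rewrite yE mul1r.
  transitivity (y * (x - c 0%N * x)); first by cring R.
  by rewrite {1}xE; cring R.
have mw : ideal_mul m (gen s) (lincomb (c \o S) s).
  by apply/ideal_mul_genP => //; exists (c \o S); split=> // i ltis; apply: mc.
have sB' : gen s `<=` B.
  apply: IHs => u gu.
  have [|b' [_ [Bb' /(ideal_mul_genP _ _ idm)[c' [mc' ->]] uE]]] := sB u.
    by apply: genS gu => z zs; rewrite in_cons zs orbT.
  exists (b' + c' 0%N * (y * b)), (c' 0%N * (y * lincomb (c \o S) s) + lincomb (c' \o S) s); split.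
  - by apply: (idealD idB) => //; do 2!apply: (idealM idB).
  - apply: (idealD (ideal_mul_ideal _ _)); first by do 2!apply: (idealM (ideal_mul_ideal _ _)).
    by apply/ideal_mul_genP => //; exists (c' \o S); split=> // i ltis; apply: mc'.
  - by rewrite uE lincomb_cons {1}xE'; cring R.
apply: gen_sub => // z; rewrite in_cons => /orP[/eqP ->|zs]; last first.
  by apply: sB'; apply: gen_in.
rewrite xE'; apply: (idealD idB); apply: (idealM idB) => //.
by apply: sB'; apply: gen_lincomb.
Qed.

Lemma nakayama_ideal m B N : noetherian R -> in_jacobson m -> ideal B -> ideal N ->
  N `<=` ideal_add B (ideal_mul m N) -> N `<=` B.
Proof. by move=> noeth jm idB /noeth[s <-]; apply: nakayama. Qed.

Definition colon B u : set R := [set r | B (r * u)].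

Lemma colon_ideal B u : ideal B -> ideal (colon B u).
Proof.
move=> idB; apply/idealP; split; rewrite /colon /=.
- by rewrite mul0r; apply: (ideal0 idB).
- by move=> x y Bx By; rewrite mulrDl; apply: (idealD idB).
- by move=> r x Bx; rewrite -mulrA; apply: (idealM idB).
Qed.

(** A maximal proper ideal of the form (B : v) is prime, for if x y v is in B and
    y v is not, then (B : y v) equals (B : v) and contains x. *)
Lemma zero_divisor_ass B u : noetherian R -> ideal B -> ~ B u ->
  exists v, [/\ ~ B v, prime_ideal (colon B v) & colon B u `<=` colon B v].
Proof.
move=> noeth idB nBu.
have [||P [v [nBv uv ->]] maxP] := @noetherian_max
   [set P | exists v, [/\ ~ B v, colon B u `<=` colon B v & P = colon B v]] noeth.
- by move=> _ [v [_ _ ->]]; apply: colon_ideal.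
- by exists (colon B u), u; split.
exists v; split=> //; apply/primeP; split.
- exact: colon_ideal.
- by rewrite /colon /= mul1r.
move=> x y; rewrite /colon /= => Bxyv.
have [|nByv] := pselect (B (y * v)); [by right|left].
have vyv : colon B v `<=` colon B (y * v).
  by move=> r Brv; rewrite /colon /= mulrCA; apply: (idealM idB).
apply: (maxP (colon B (y * v))) => //; last by rewrite /colon /= mulrA.
by exists (y * v); split=> //; apply: (subset_trans uv).
Qed.

(** Noetherian induction on B. If P = (B : u) is prime, the exact sequence
    0 -> R/P -> R/B -> R/(B + (u)) -> 0 shows that any other associated prime of B
    is associated to B + (u). *)
Lemma finite_ass B : noetherian R -> ideal B ->
  exists L : seq (set R),
    forall u, ~ B u -> prime_ideal (colon B u) -> List.In (colon B u) L.
Proof.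
move=> noeth idB0; apply: contrapT => nB0.
pose bad B := ideal B /\ ~ exists L : seq (set R),
    forall u, ~ B u -> prime_ideal (colon B u) -> List.In (colon B u) L.
have [||{idB0 nB0}C [idB nB] maxB] := @noetherian_max bad noeth.
- by move=> I [].
- by exists B.
apply: nB.
have [BT|] := pselect (forall u, C u); first by exists [::] => u [].
move/existsNP => [u0 nBu0].
have [u [nBu prP _]] := zero_divisor_ass noeth idB nBu0.
have [L LP] : exists L : seq (set R), forall v, ~ ideal_addp C u v ->
    prime_ideal (colon (ideal_addp C u) v) -> List.In (colon (ideal_addp C u) v) L.
  apply: contrapT => nL; apply: nBu.
  by apply: (maxB (ideal_addp C u)); [split=> //; apply: ideal_addp_ideal|exact: ideal_addp_sub|exact: ideal_addp_in].
exists (colon C u :: L) => v nBv prv.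
have [[r [s [rv nrv]]]|no] :=
    pselect (exists r (s : R), C (r * v - s * u) /\ ~ C (r * v)).
  have nsu : ~ C (s * u).
    by move=> Bsu; apply: nrv; rewrite -(subrK (s * u) (r * v)); apply: (idealD idB).
  left; apply/seteqP; split=> a; rewrite /colon /= => Ba.
    have: C (r * (a * v)).
      have -> : r * (a * v) = a * (r * v - s * u) + s * (a * u) by cring R.
      by apply: (idealD idB); apply: (idealM idB).
    move=> Brav; case/primeP: prv => _ _ /(_ r a); rewrite /colon /= -mulrA.
    by case.
  have Bsau : C (s * a * u).
    have -> : s * a * u = r * (a * v) - a * (r * v - s * u) by cring R.
    by apply: (idealB idB); apply: (idealM idB).
  by case/primeP: prP => _ _ /(_ s a) []; rewrite /colon /=.
right; have E : colon (ideal_addp C u) v = colon C v.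
  apply/seteqP; split=> a; rewrite /colon /=; last exact: ideal_addp_sub.
  move=> [b [r [Bb avE]]]; apply: contrapT => nBav; apply: no.
  by exists a, r; rewrite avE addrK -avE.
rewrite -E; apply: LP; rewrite ?E // => Bv.
by case/primeP: prv; rewrite -E /colon /= mul1r.
Qed.

(** Induction on the number of primes. If P contains another prime of the list, it
    is enough to avoid P and the rest. Otherwise, an x + r avoiding the rest but
    lying in P is moved out of P by an element of Q that lies in all the other
    primes and not in P. *)
Lemma coset_avoidance (L : seq (set R)) x Q : ideal Q ->
  (forall P, List.In P L -> prime_ideal P) ->
  (forall P, List.In P L -> ~ (ideal_addp Q x `<=` P)) ->
  exists2 r, Q r & forall P, List.In P L -> ~ P (x + r).
Proof.
move=> idQ; move: {-1}(size L) (leqnn (size L)) => n.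
elim: n L => [|n IHn] [|P L] //= szL prL QL; try by exists 0; [exact: (ideal0 idQ)|].
have [[P' LP' P'P]|noP] := pselect (exists2 P', List.In P' L & P' `<=` P).
  have [L1 [L2 LE]] := List.in_split _ _ LP'.
  have inL A : List.In A (P :: L1 ++ L2) -> List.In A (P :: L).
    case=> [->|]; first by left.
    move=> /List.in_app_iff[H|H]; right; rewrite LE; apply/List.in_app_iff.
      by left.
    by right; right.
  have [|A /inL /prL|A /inL /QL|r Qr rL] // := IHn (P :: L1 ++ L2).
    by move: szL; rewrite LE (size_cat L1 (P' :: L2)) /= size_cat addnS.
  exists r => // A [<-|]; first by apply: rL; left.
  rewrite LE => /List.in_app_iff[AL|[<-|AL]].
  - by apply: rL; right; apply/List.in_app_iff; left.
  - by move/P'P; apply: rL; left.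
  - by apply: rL; right; apply/List.in_app_iff; right.
have [||r Qr rL] := IHn L szL.
- by move=> A AL; apply: prL; right.
- by move=> A AL; apply: QL; right.
have [Pxr|] := pselect (P (x + r)); last first.
  by move=> nP; exists r => // A [<-|/rL].
have /primeP[idP P1 Ppr] := prL P (or_introl erefl).
have [q Qq nPq] : exists2 q, Q q & ~ P q.
  apply: contrapT => no; apply: (QL P (or_introl erefl)); apply: ideal_addp_min => //.
    by move=> q Qq; apply: contrapT => nPq; apply: no; exists q.
  by apply: (idealDr idP _ Pxr); apply: contrapT => nPr; apply: no; exists r.
have [t Lt nPt] : exists2 t, (forall A, List.In A L -> A t) & ~ P t.
  have: forall A, List.In A L -> ~ (A `<=` P).
    by move=> A AL AP; apply: noP; exists A.
  have: forall A, List.In A L -> ideal A.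
    by move=> A AL; have /primeP[] := prL A (or_intror AL).
  elim: (L) => [|A M IHM] idM nM; first by exists 1.
  have [||t tM nPt] := IHM.
  - by move=> B BM; apply: idM; right.
  - by move=> B BM; apply: nM; right.
  have [a Aa nPa] : exists2 a, A a & ~ P a.
    apply: contrapT => no; apply: (nM A (or_introl erefl)) => a Aa.
    by apply: contrapT => nPa; apply: no; exists a.
  exists (a * t) => [B [<-|BM]|/Ppr[]//].
    exact: (idealMr (idM _ (or_introl erefl))).
  by apply: (idealM (idM _ (or_intror BM))); apply: tM.
exists (r + q * t); first by apply: (idealD idQ) => //; apply: (idealMr idQ).
move=> A [<-|AL]; rewrite addrA.
  by rewrite addrC => /(idealDr idP Pxr) H; case: (Ppr q t).
have /primeP[idA _ _] := prL A (or_intror AL).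
move=> H; apply: (rL A AL); apply: (idealDr idA _ H).
by apply: (idealM idA); apply: Lt.
Qed.

Definition nzd B z := forall a, B (z * a) -> B a.

(** The hypotheses say that no associated prime of B1 or B2 contains Q + (x), so
    some element of x + Q avoids all of them. Serving two ideals at once is what
    the proof of [depth_exchange] asks for. *)
Lemma exists_nzd B1 B2 x Q : noetherian R -> ideal B1 -> ideal B2 -> ideal Q ->
  (forall u, (forall q, ideal_addp Q x q -> B1 (q * u)) -> B1 u) ->
  (forall u, (forall q, ideal_addp Q x q -> B2 (q * u)) -> B2 u) ->
  exists2 r, Q r & nzd B1 (x + r) /\ nzd B2 (x + r).
Proof.
move=> noeth id1 id2 idQ H1 H2.
have sel B : ideal B -> (forall u, (forall q, ideal_addp Q x q -> B (q * u)) -> B u) ->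
  exists L : seq (set R),
    [/\ forall P, List.In P L -> prime_ideal P,
        forall P, List.In P L -> ~ (ideal_addp Q x `<=` P)
      & forall z, (forall P, List.In P L -> ~ P z) -> nzd B z].
  move=> idB HB; have [L LP] := finite_ass noeth idB.
  pose good (P : set R) := `[< prime_ideal P /\ exists2 u, ~ B u & P = colon B u >].
  exists (List.filter good L); split.
  - by move=> P /List.filter_In[_ /asboolP[]].
  - move=> P /List.filter_In[_ /asboolP[_ [u nBu ->]]] sub.
    by apply: nBu; apply: HB => q /sub.
  - move=> z zL a Bza; apply: contrapT => nBa.
    have [v [nBv prv av]] := zero_divisor_ass noeth idB nBa.
    apply: (zL (colon B v)); last exact: av.
    by apply/List.filter_In; split; [exact: LP|apply/asboolP; split=> //; exists v].
have [L1 [pr1 sub1 nz1]] := sel _ id1 H1.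
have [L2 [pr2 sub2 nz2]] := sel _ id2 H2.
have [||r Qr rL] := @coset_avoidance (L1 ++ L2)%list x Q idQ.
- by move=> P /List.in_app_iff[]; [apply: pr1|apply: pr2].
- by move=> P /List.in_app_iff[]; [apply: sub1|apply: sub2].
exists r => //; split; [apply: nz1|apply: nz2] => P PL; apply: rL; apply/List.in_app_iff;
  by [left|right].
Qed.

End Noetherian.

(** * Depth *)

Section Depth.
Context {R : comNzRingType}.
Add Ring ring3 : (ring_axioms R).
Implicit Types (I J K B P Q : set R) (s : seq R) (x y z u v t : R) (c : nat -> R).

(** The existence of a regular sequence of length d on R/B, unfolded one element
    at a time so that inductions on d can pass to B + (z). *)
Fixpoint depth_ge (m B : set R) (d : nat) : Prop :=
  if d is d'.+1 then exists z, [/\ m z, nzd B z & depth_ge m (ideal_addp B z) d'] else True.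

Fixpoint regular_over B s : Prop :=
  if s is x :: s' then nzd B x /\ regular_over (ideal_addp B x) s' else True.

Lemma nzdX B z n : nzd B z -> nzd B (z ^+ n).
Proof.
by move=> Bz; elim: n => [|n IHn] a; rewrite ?mul1r // exprS -mulrA => /Bz /IHn.
Qed.

Hypothesis noeth : noetherian R.
Variables (m : set R) (jm : in_jacobson m).
Let idm : ideal m := jm.1.

(** Only the regularity of c takes more than a computation: the ideal A of the a
    with c a in B satisfies A = B + z A, so that A = B by Nakayama's lemma. *)
Lemma nzd_swap B z (c : R) : ideal B -> m z -> nzd B z -> nzd (ideal_addp B z) c ->
  nzd B c /\ nzd (ideal_addp B c) z.
Proof.
move=> idB mz Bz Bzc; split; last first.
  move=> a [b [r [Bb zaE]]].
  have [|b' [r' [Bb' rE]]] := Bzc r.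
    exists (- b), a; split; first exact: (idealN idB).
    by rewrite [a * z]mulrC zaE; cring R.
  exists (a - c * r'), r'; split; last by cring R.
  apply: Bz; have -> : z * (a - c * r') = z * a - z * c * r' by cring R.
  rewrite zaE rE; have -> : b + (b' + r' * z) * c - z * c * r' = b + c * b' by cring R.
  by apply: (idealD idB) => //; apply: (idealM idB).
move=> a Bca; pose A := [set a | B (c * a)].
have idA : ideal A.
  apply/idealP; rewrite /A; split=> /= [|x y|r x].
  - by rewrite mulr0; apply: (ideal0 idB).
  - by rewrite mulrDr; apply: (idealD idB).
  - by rewrite mulrCA; apply: (idealM idB).
apply: (nakayama_ideal noeth jm idB idA _ Bca) => x /= Bcx.
have [|b [r [Bb xE]]] := Bzc x; first exact: ideal_addp_sub.
exists b, (r * z); split=> //; rewrite mulrC; apply: ideal_mul_in => //=.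
apply: Bz; have -> : z * (c * r) = c * x - c * b by rewrite xE; cring R.
by apply: (idealB idB) => //; apply: (idealM idB).
Qed.

(** Let z be the first element of the given sequence, and choose c regular modulo
    both B + (z) and B + (x): then x can be exchanged for c, and c for z, in
    smaller depth. Such a c exists because an element u killed by m modulo
    B + (x) would lead, through z u = x v, to an element v killed by m modulo
    B + (z). *)
Lemma depth_exchange d B x : ideal B -> m x -> nzd B x -> depth_ge m B d.+1 ->
  depth_ge m (ideal_addp B x) d.
Proof.
elim: d B x => [|d IHd] B x //= idB mx Bx.
move=> [z [mz Bz [w [mw Bzw depw]]]].
have [|||||c mc [Bzc Bxc]] := @exists_nzd _ (ideal_addp B z) (ideal_addp B x) 0 m noeth; try exact: ideal_addp_ideal.
- exact: idm.
- by move=> u mu; apply: Bzw; apply: mu; apply: ideal_addp_sub.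
- move=> u mu.
  have [|b [v [Bb zuE]]] := mu z; first exact: ideal_addp_sub.
  have [b' [t [Bb' vE]]] : ideal_addp B z v.
    apply: Bzw.
    have [|b1 [r1 [Bb1 wuE]]] := mu w; first exact: ideal_addp_sub.
    exists (w * v - r1 * z), r1; split; last by cring R.
    apply: Bx; have -> : x * (w * v - r1 * z) = w * (b + v * x) - w * b - z * (b1 + r1 * x) + z * b1 by cring R.
    rewrite -zuE -wuE.
    have -> : w * (z * u) - w * b - z * (w * u) + z * b1 = z * b1 - w * b by cring R.
    by apply: (idealB idB); apply: (idealM idB).
  exists (u - t * x), t; split; last by cring R.
  apply: Bz; have -> : z * (u - t * x) = b + b' * x.
    by rewrite mulrBr zuE vE; cring R.
  by apply: (idealD idB) => //; apply: (idealMr idB).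
rewrite add0r in Bzc Bxc.
have depzc : depth_ge m (ideal_addp (ideal_addp B z) c) d.
  apply: IHd => //; first exact: ideal_addp_ideal.
  by exists w.
have [Bc Bcz] := nzd_swap idB mz Bz Bzc.
have [_ Bcx] := nzd_swap idB mx Bx Bxc.
exists c; split=> //; rewrite ideal_addpC; apply: IHd => //; first exact: ideal_addp_ideal.
by exists z; split=> //; rewrite ideal_addpC.
Qed.

(** By avoidance in the coset x + (s), the first generator can be corrected by the
    others into a nonzerodivisor, and [depth_exchange] provides the depth modulo
    this nonzerodivisor. *)
Lemma regular_generators b B s k : ideal B -> {in s, forall x, m x} ->
  ideal_exp m b `<=` ideal_addl B s -> depth_ge m B (size s + k) ->
  exists s', [/\ size s' = size s, {in s', forall x, m x}, regular_over B s',
     ideal_addl B s' = ideal_addl B s & depth_ge m (ideal_addl B s) k].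
Proof.
move=> + ms; elim: s B ms => [|x s IHs] B ms idB /= msub depB.
  by exists [::].
have depB1 := depB; case: depB1 => z [mz Bz _].
have avoid u : (forall q, ideal_addp (gen s) x q -> B (q * u)) -> B u.
  move=> uP; apply: (nzdX (n := b) Bz); have: ideal_addl B (x :: s) (z ^+ b).
    by apply: msub; apply: ideal_exp_in.
  move=> /ideal_addlP[b' [v [Bb' gv ->]]]; rewrite mulrDl; apply: (idealD idB).
    exact: (idealMr idB).
  apply: uP; move/gen_cons_inP: gv => [r [w [gw ->]]].
  by exists w, r; rewrite addrC.
have [r gr [Bx _]] := exists_nzd noeth idB idB (ideal_ideal_gen _) avoid avoid.
have ms' : {in s, forall x, m x} by move=> y ys; apply: ms; rewrite in_cons ys orbT.
have mx' : m (x + r).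
  apply: (idealD idm); first by apply: ms; rewrite mem_head.
  by apply: (gen_sub idm ms').
have E : ideal_addl (ideal_addp B (x + r)) s = ideal_addl (ideal_addp B x) s.
  apply/seteqP; split=> u /ideal_addlP[b1 [v [[b2 [q [Bb2 ->]]] gv ->]]]; apply/ideal_addlP.
    exists (b2 + q * x), (q * r + v); split; [by exists b2, q| |by cring R].
    by apply: (idealD (ideal_ideal_gen _)) => //; apply: (idealM (ideal_ideal_gen _)).
  exists (b2 + q * (x + r)), (v - q * r); split; [by exists b2, q| |by cring R].
  by apply: (idealB (ideal_ideal_gen _)) => //; apply: (idealM (ideal_ideal_gen _)).
have [||||s' [szs' mns' rs' Es' dep']] := IHs (ideal_addp B (x + r)).
- by [].
- exact: ideal_addp_ideal.
- by rewrite E.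
- exact: depth_exchange.
exists (x + r :: s'); split=> //=.
- by rewrite szs'.
- by move=> y; rewrite in_cons => /orP[/eqP ->|/mns'].
- by rewrite Es' E.
- by rewrite -E.
Qed.

End Depth.

(** * Monomials and quasi-regular sequences *)

Section Monomials.
Context {R : comNzRingType}.
Add Ring ring4 : (ring_axioms R).
Implicit Types (I J K B P Q : set R) (s : seq R) (x y z u v t : R) (c : nat -> R).

(** Monomials of degree i, by recursion on the variables and then on the degree.
    Those divisible by the first variable come first, so that the decomposition
    F = x H + G of a form is a splitting of its list of coefficients. *)
Fixpoint mons_cons (x : R) (ms : nat -> seq R) (i : nat) : seq R :=
  if i is i'.+1 then [seq x * y | y <- mons_cons x ms i'] ++ ms i else ms 0%N.

Fixpoint mons s (i : nat) : seq R :=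
  if s is x :: s' then mons_cons x (mons s') i else
  if i is 0 then [:: 1] else [::].

Lemma mons0 s : mons s 0 = [:: 1].
Proof. by elim: s. Qed.

Lemma mons_consS x s i :
  mons (x :: s) i.+1 = [seq x * y | y <- mons (x :: s) i] ++ mons s i.+1.
Proof. by []. Qed.

Lemma mons1 s : mons s 1 = s.
Proof. by elim: s => // x s IHs; rewrite mons_consS mons0 IHs /= mulr1. Qed.

Fixpoint nmons (d i : nat) : nat :=
  match d, i with
  | 0, 0 => 1
  | 0, _.+1 => 0
  | d'.+1, _ => (fix f j := if j is j'.+1 then (f j' + nmons d' j)%N else nmons d' 0) i
  end.

Lemma nmonsS d i : nmons d.+1 i.+1 = (nmons d.+1 i + nmons d i.+1)%N.
Proof. by []. Qed.

Lemma nmons0 d : nmons d 0 = 1%N.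
Proof. by elim: d. Qed.

Lemma nmons1 d : nmons d 1 = d.
Proof. by elim: d => // d IHd; rewrite nmonsS nmons0 IHd. Qed.

Lemma size_mons s i : size (mons s i) = nmons (size s) i.
Proof.
elim: s i => [|x s IHs] [|i] //; first by rewrite mons0 nmons0.
elim: i => [|i IHi]; last by rewrite mons_consS size_cat size_map IHi IHs.
by rewrite mons_consS size_cat size_map mons0 IHs /= nmons0.
Qed.

Lemma nmons_bin d i : nmons d.+1 i = 'C(i + d, d).
Proof.
elim: d i => [|d IHd] i.
  elim: i => [//|i IHi]; rewrite nmonsS IHi addn0 !bin0; by rewrite addn0.
elim: i => [|i IHi]; first by rewrite nmons0 binn.
by rewrite nmonsS IHi IHd addSnnS addSn binS.
Qed.

Lemma mons_ideal_exp I s i : ideal I -> {in s, forall x, I x} ->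
  {in mons s i, forall x, ideal_exp I i x}.
Proof.
move=> idI; elim: s i => [|x s IHs] [|i] sI y; rewrite ?mons0 //; try by [].
have sI' : {in s, forall x, I x} by move=> z zs; apply: sI; rewrite in_cons zs orbT.
elim: i y => [|i IHi] y; rewrite mons_consS mem_cat => /orP[/mapP[z zs ->]|/IHs]; try exact.
  rewrite mons0 inE in zs; rewrite (eqP zs); apply: ideal_mul_in => //.
  by apply: sI; rewrite mem_head.
apply: ideal_mul_in; first by apply: sI; rewrite mem_head.
exact: IHi.
Qed.

Lemma mons_mul s i x t : x \in s -> t \in mons s i -> x * t \in mons s i.+1.
Proof.
elim: s i t => [|a s IHs] // i t; rewrite in_cons => /orP[/eqP ->|xs].
  by move=> tm; rewrite mons_consS mem_cat map_f.
elim: i t => [|i IHi] t.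
  rewrite mons0 inE => /eqP ->; rewrite mulr1 mons1 in_cons xs orbT //.
rewrite mons_consS mem_cat => /orP[/mapP[z zm ->]|tm].
  by rewrite mons_consS mem_cat mulrCA map_f // IHi.
by rewrite mons_consS mem_cat IHs ?orbT.
Qed.

Lemma gen_mons s i : ideal_exp (gen s) i = gen (mons s i).
Proof.
apply/seteqP; split; last first.
  apply: gen_sub => // y; apply: mons_ideal_exp => // x.
  exact: gen_in.
elim: i => [|i IHi] /=.
  rewrite mons0 => u _; apply/genP; exists (fun=> u).
  by rewrite lincomb_cons lincomb_nil mulr1 addr0.
apply: (subset_trans (ideal_mulS (@subset_refl _ _) IHi)).
rewrite gen_mul; apply: gen_subl => _ /allpairsP[[x y] /= [xs ym ->]].
by apply: gen_in; apply: mons_mul.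
Qed.

(** Regular sequences listed backwards: the recursion of [mons] singles out the
    head, which has to be the last element of the sequence. *)
Fixpoint rev_regular s : Prop :=
  if s is x :: s' then nzd (gen s') x /\ rev_regular s' else True.

Lemma regular_over_rev s : regular_over [set 0] s -> rev_regular (rev s).
Proof.
have H B (t : seq R) : rev_regular t -> B = gen t -> regular_over B s -> rev_regular (rev s ++ t).
  elim: s B t => [|x s IHs] B t //= tr Bt [Bx rs].
  rewrite rev_cons cat_rcons; apply: (IHs (ideal_addp B x)) => //=; first by rewrite -Bt.
  rewrite Bt; apply/seteqP; split=> u.
    move=> [b [r [gb ->]]]; apply/gen_cons_inP; exists r, b; split=> //.
    by rewrite addrC.
  by move=> /gen_cons_inP[r [b [gb ->]]]; exists b, r; rewrite addrC.
by move=> /(H [set 0] [::] I); rewrite cats0; apply; rewrite gen_nil.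
Qed.

Lemma gen_rev s : gen (rev s) = gen s.
Proof. by apply/seteqP; split; apply: genS => x; rewrite mem_rev. Qed.

(** Write the form as F = x H + G with G free of x, and let q' be generated by the
    other variables. Since x is regular modulo every power of q', the value of H
    is in a power of q', which puts the coefficients of H in q by induction on the
    degree, and makes x H a form in the other variables, to be added to G. *)
Lemma quasi_regular0 s : rev_regular s -> forall i c,
  lincomb c (mons s i) = 0 -> forall j, (j < size (mons s i))%N -> gen s (c j).
Proof.
elim: s => [_ [|i] c|x s IHs [sx rs]] //=.
  rewrite lincomb_cons lincomb_nil mulr1 addr0 => c0 [|j] // _; rewrite c0.
  exact: (ideal0 (ideal_ideal_gen _)).
have {IHs}QR := IHs rs.
have sub : gen s `<=` gen (x :: s).
  by apply: genS => z zs; rewrite in_cons zs orbT.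
have xX i : nzd (ideal_exp (gen s) i) x.
  elim: i => [|i IHi] a //; rewrite gen_mons => xa.
  have := xa; rewrite -gen_mons => /(ideal_exp_le (ideal_ideal_gen _) (leqnSn i)) /IHi.
  rewrite gen_mons => /genP[c aE].
  have Hc j : (j < size (mons s i))%N -> gen s (c j).
    move=> ltj; apply: sx.
    have: ideal_mul (gen s) (gen (mons s i)) (x * a).
      by rewrite -gen_mons -ideal_expS gen_mons.
    move=> /(ideal_mul_genP _ _ (ideal_ideal_gen _))[c' [sc' xaE]].
    have : lincomb (fun j => x * c j - c' j) (mons s i) = 0.
      by rewrite lincombB lincombZ -aE -xaE subrr.
    move=> /QR/(_ j ltj) H; rewrite -(subrK (c' j) (x * c j)).
    by apply: (idealD (ideal_ideal_gen _)) => //; apply: sc'.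
  rewrite ideal_expS aE gen_mons; apply/ideal_mul_genP; first exact: ideal_ideal_gen.
  by exists c.
elim=> [|i IHi] c.
  rewrite -[mons_cons _ _ _]/(mons (x :: s) 0) mons0 lincomb_cons lincomb_nil mulr1 addr0 => c0 [|j] // _.
  by rewrite c0; apply: (ideal0 (ideal_ideal_gen _)).
rewrite -[mons_cons _ _ _]/(mons (x :: s) i.+1) mons_consS lincomb_cat size_map lincomb_map.
set n := size (mons (x :: s) i); set H := lincomb c _; set G := lincomb _ _ => E.
have /xX : ideal_exp (gen s) i.+1 (x * H).
  rewrite gen_mons; have -> : x * H = - G by rewrite -[RHS]add0r -E; cring R.
  by apply: (idealN (ideal_ideal_gen _)); apply: gen_lincomb.
move=> HinS; have cH j : (j < n)%N -> gen (x :: s) (c j).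
  move=> ltj.
  have: ideal_mul (gen (x :: s)) (gen (mons (x :: s) i)) H.
    by rewrite -gen_mons -ideal_expS; apply: ideal_exp_sub HinS.
  move=> /(ideal_mul_genP _ _ (ideal_ideal_gen _))[c' [sc' HE]].
  have : lincomb (fun j => c j - c' j) (mons (x :: s) i) = 0 by rewrite lincombB -/H HE subrr.
  move=> /IHi/(_ j ltj) D; rewrite -(subrK (c' j) (c j)).
  by apply: (idealD (ideal_ideal_gen _)) => //; apply: sc'.
move: HinS; rewrite gen_mons => /genP[h HE].
have : lincomb (fun j => x * h j + c (n + j)%N) (mons s i.+1) = 0 by rewrite lincombD lincombZ -HE.
move=> /QR QRG j; rewrite size_cat size_map -/n => ltj.
have [/cH//|lenj] := ltnP j n.
have := QRG (j - n)%N; rewrite subnKC // => /(_ _)/sub D.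
have : gen (x :: s) (x * h (j - n)%N).
  by apply: (idealMr (ideal_ideal_gen _)); apply: gen_in; rewrite mem_head.
move=> D'; apply: (idealDr (ideal_ideal_gen _) D').
by rewrite addrC; apply: D; lia.
Qed.

Lemma quasi_regular s i c : rev_regular s -> ideal_exp (gen s) i.+1 (lincomb c (mons s i)) ->
  forall j, (j < size (mons s i))%N -> gen s (c j).
Proof.
move=> rs; rewrite ideal_expS gen_mons.
move=> /(ideal_mul_genP _ _ (ideal_ideal_gen _))[c' [sc' HE]] j ltj.
have : lincomb (fun j => c j - c' j) (mons s i) = 0 by rewrite lincombB HE subrr.
move=> /(quasi_regular0 rs)/(_ j ltj) D; rewrite -(subrK (c' j) (c j)).
by apply: (idealD (ideal_ideal_gen _)) => //; apply: sc'.
Qed.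

End Monomials.

(** * Independence modulo an ideal *)

Section Independence.
Context {R : comNzRingType}.
Add Ring ring5 : (ring_axioms R).
Implicit Types (I J K B P Q : set R) (s v w : seq R) (x y z u t : R) (c : nat -> R).

(** For a maximal ideal m and K = m I, this is independence of the images of v in
    the vector space I/mI. *)
Definition indep (m K : set R) v :=
  forall c, K (lincomb c v) -> forall j, (j < size v)%N -> m (c j).

Lemma det_congr m n (A B : 'M[R]_n) : ideal m ->
  (forall i j, m (A i j - B i j)) -> m (\det A - \det B).
Proof.
move=> idm AB.
rewrite /determinant -sumrB; apply: (ideal_sum idm) => s _; rewrite -mulrBr.
apply: (idealM idm).
have telescope (a b p q : R) : a * p - b * q = (a - b) * p + b * (p - q) by cring R.
elim/big_rec2: _ => [|i x y _ IH]; first by rewrite subrr; apply: (ideal0 idm).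
rewrite telescope; by apply: (idealD idm); [apply: (idealMr idm)|apply: (idealM idm)].
Qed.

Lemma det_unit m n (A : 'M[R]_n) : in_jacobson m ->
  (forall i j, m (A i j - (i == j)%:R)) -> exists y, \det A * y = 1.
Proof.
move=> [idm jm] A1.
have : m (\det A - \det (1%:M : 'M_n)) by apply: det_congr => // i j; rewrite mxE.
by rewrite det1 => /jm; rewrite addrC subrK.
Qed.

Lemma gen_matrix v w : gen v `<=` gen w ->
  exists A : nat -> nat -> R, forall i, v`_i = lincomb (A i) w.
Proof.
move=> vw; have /choice[A AE] : forall i, exists a, v`_i = lincomb a w.
  by move=> i; apply/genP; apply: vw; apply: gen_nth.
by exists A.
Qed.

Lemma lincomb_matrix c v w (A : nat -> nat -> R) : (forall i, v`_i = lincomb (A i) w) ->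
  lincomb c v = lincomb (fun j => \sum_(i < size v) c i * A i j) w.
Proof.
move=> vE; rewrite /lincomb; under eq_bigr do rewrite vE mulr_sumr.
rewrite exchange_big; apply: eq_bigr => j _; rewrite mulr_suml.
by apply: eq_bigr => i _; rewrite mulrA.
Qed.

Section Matrices.
Variables (m K : set R) (jm : in_jacobson m) (idK : ideal K) (v w : seq R).
Hypotheses (vw : gen v = gen w) (vi : indep m K v).

(** Two generating families v and w are related by matrices A and B; independence
    of v makes A B congruent to 1 modulo m, hence of unit determinant. *)
Lemma change_of_basis : exists a b : nat -> nat -> R,
  (forall i, w`_i = lincomb (b i) v) /\
  exists y, \det ((\matrix_(i < size v, j < size w) a i j) *m
                 (\matrix_(i < size w, j < size v) b i j)) * y = 1.
Proof.
have [a aE] : exists A : nat -> nat -> R, forall i, v`_i = lincomb (A i) w.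
  by apply: gen_matrix; rewrite vw.
have [b bE] : exists A : nat -> nat -> R, forall i, w`_i = lincomb (A i) v.
  by apply: gen_matrix; rewrite vw.
exists a, b; split=> //; apply: (det_unit jm) => i j.
have /vi : K (lincomb (fun j => \sum_(k < size w) a i k * b k j - (i == j :> nat)%:R) v).
  rewrite lincombB -(lincomb_matrix _ bE) -aE.
  suff -> : lincomb (fun j => (i == j :> nat)%:R) v = v`_i by rewrite subrr; apply: (ideal0 idK).
  by rewrite -[RHS](lincomb_delta (ltn_ord i)); apply: eq_lincomb => k _; rewrite eq_sym.
move=> /(_ j (ltn_ord j)); rewrite !mxE -val_eqE.
by under [X in _ -> m (X - _)]eq_bigr do rewrite !mxE.
Qed.

Lemma indep_size_le : (size v <= size w)%N.
Proof.
have [a [b [_ ]]] := change_of_basis; set A := \matrix_(_, _) _; set B := \matrix_(_, _) _.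
move=> [y yE]; apply: (mulmx1_min (A := A) (B := B *m (y *: \adj (A *m B)))).
by rewrite mulmxA -scalemxAr mul_mx_adj scale_scalar_mx mulrC yE.
Qed.

(** For families of the same size B is square, and its determinant divides a unit;
    thus coefficients of w are recovered from coefficients of v. *)
Lemma spanning_indep : size v = size w -> indep m K w.
Proof.
move=> szvw; have [a [b [bE]]] := change_of_basis.
rewrite -szvw; set A := \matrix_(_, _) _; set B := \matrix_(_, _) _ => -[y yE] c.
rewrite (lincomb_matrix _ bE) -szvw => /vi cB j ltj.
pose r : 'rV[R]_(size v) := \row_i c i.
have [idm _] := jm.
have -> : c j = (r *m B *m ((y * \det A) *: \adj B)) 0 (Ordinal ltj).
  rewrite -mulmxA -scalemxAr mul_mx_adj scale_scalar_mx.
  have -> : y * \det A * \det B = 1 by rewrite -mulrA mulrC -det_mulmx.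
  by rewrite mulmx1 mxE.
rewrite mxE; apply: (ideal_sum idm) => k _; apply: (idealMr idm).
rewrite mxE; under eq_bigr do rewrite !mxE; exact: cB.
Qed.

End Matrices.

Lemma mons_head y s i : mons (y :: s) i = y ^+ i :: behead (mons (y :: s) i).
Proof.
elim: i => [|i IHi]; first by rewrite mons0.
by rewrite mons_consS IHi /= exprS.
Qed.

Lemma mons_behead y s i x t : x \in s -> t \in mons (y :: s) i ->
  x * t \in behead (mons (y :: s) i.+1).
Proof.
move=> xs; elim: i t => [|i IHi] t.
  by rewrite mons0 inE => /eqP ->; rewrite mulr1 mons1.
move=> tm; rewrite [mons (y :: s) i.+2]mons_consS [mons (y :: s) i.+1]mons_head.
move: tm; rewrite mons_consS mem_cat => /orP[/mapP[z zm ->]|tm].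
  by rewrite /= mem_cat mulrCA map_f // IHi.
by rewrite /= mem_cat mons_mul ?orbT.
Qed.

Lemma mul_gen_mons y s i u : ideal_mul (gen s) (ideal_exp (gen (y :: s)) i) u ->
  exists c, c 0%N = 0 /\ u = lincomb c (mons (y :: s) i.+1).
Proof.
rewrite gen_mons gen_mul => gu.
have /genP[c ->] : gen (behead (mons (y :: s) i.+1)) u.
  move: gu; apply: gen_subl => _ /allpairsP[[x t] /= [xs ts ->]].
  by apply: gen_in; apply: mons_behead.
exists (fun i => if i is i'.+1 then c i' else 0); split=> //.
by rewrite [in RHS]mons_head lincomb_cons mul0r add0r.
Qed.

Lemma behead_mons_in y s i t : t \in behead (mons (y :: s) i.+1) ->
  ideal_mul (gen s) (ideal_exp (gen (y :: s)) i) t.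
Proof.
elim: i t => [|i IHi] t.
  by rewrite mons1 => ts; rewrite ideal_mulT //; apply: gen_in.
rewrite mons_consS [mons (y :: s) i.+1]mons_head /= mem_cat => /orP[/mapP[z zm ->]|tm].
  rewrite ideal_mulA [ideal_mul (gen s) _]ideal_mulC -ideal_mulA.
  by apply: ideal_mul_in; [apply: gen_in; rewrite mem_head|apply: IHi].
have sub : gen s `<=` gen (y :: s) by apply: genS => z zs; rewrite in_cons zs orbT.
apply: (ideal_mulS (@subset_refl _ _) (ideal_exp_sub (n := i.+1) sub)).
by rewrite -ideal_expS gen_mons; apply: gen_in.
Qed.

(** An element c y^j of (s) is pushed into (s) m^k for increasing k < j: written on
    the monomials of degree k + 1 other than y^(k+1), with a value in m^(k+2), it
    has its coefficients in m. For k + 1 = j this is a relation of degree j where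
    y^j has coefficient c. *)
Lemma powers_indep m y s f : ideal m -> m = gen (y :: s) ->
  (forall i, (i < f)%N -> indep m (ideal_exp m i.+1) (mons (y :: s) i)) ->
  forall (c : R) j, (j < f)%N -> gen s (c * y ^+ j) -> m c.
Proof.
move=> idm mE norel c j ltjf gs.
have sub : gen s `<=` m by rewrite mE; apply: genS => z zs; rewrite in_cons zs orbT.
have my : m y by rewrite mE; apply: gen_in; rewrite mem_head.
case: j ltjf gs => [|j] ltjf gs; first by rewrite expr0 mulr1 in gs; apply: sub.
have H k : (k <= j)%N -> ideal_mul (gen s) (ideal_exp m k) (c * y ^+ j.+1).
  elim: k => [_|k IHk ltkj]; first by rewrite ideal_mulT.
  have := IHk (ltnW ltkj); rewrite {1}mE => /mul_gen_mons[e [e0 eE]].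
  have me : forall i, (i < size (mons (y :: s) k.+1))%N -> m (e i).
    apply: (norel k.+1); first by lia.
    rewrite -eE; apply: (idealM (ideal_exp_ideal _ _)).
    apply: (@ideal_exp_le _ m k.+2 j.+1) => //.
    exact: ideal_exp_in.
  rewrite eE mons_head lincomb_cons e0 mul0r add0r.
  rewrite ideal_expS ideal_mulA [ideal_mul (gen s) m]ideal_mulC -ideal_mulA.
  apply: lincomb_ideal_mul => i lti.
    by apply: me; rewrite mons_head.
  by rewrite mE; apply: behead_mons_in; apply: mem_nth.
have := H j (leqnn j); rewrite {1}mE => /mul_gen_mons[e [e0 eE]].
have := norel j.+1 ltjf (fun i => (i == 0%N)%:R * c - e i).
have -> : lincomb (fun i => (i == 0%N)%:R * c - e i) (mons (y :: s) j.+1) = 0.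
  apply/eqP; rewrite lincombB -eE subr_eq0; apply/eqP; rewrite mons_head lincomb_cons mul1r.
  by rewrite -[RHS]addr0 /lincomb big1 // => i _; rewrite /= !mul0r.
move=> /(_ (ideal0 (ideal_exp_ideal _ _)) 0%N).
by rewrite mons_head /= e0 mul1r subr0; apply.
Qed.

End Independence.

(** * The associated graded ring of a hypersurface *)

Section Filtration.
Context {R : comNzRingType}.
Add Ring ring6 : (ring_axioms R).
Implicit Types (I J K B P Q : set R) (s : seq R) (x z u t w : R) (c : nat -> R).
Implicit Types (e : nat -> nat).

Variables (m : set R) (idm : ideal m) (y : R) (xs : seq R) (f : nat).
Let q := gen xs.
Hypotheses (f_gt0 : (0 < f)%N) (mE : m = gen (y :: xs)) (rxs : rev_regular xs).
Hypothesis reduction : ideal_exp m f `<=` ideal_mul q (ideal_exp m f.-1).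
Hypothesis ypow : forall (c : R) j, (j < f)%N -> q (c * y ^+ j) -> m c.

Let idq : ideal q := ideal_ideal_gen _.
Let idqn n : ideal (ideal_exp q n) := ideal_exp_ideal _ _.
Let idmn n : ideal (ideal_exp m n) := ideal_exp_ideal _ _.
Hint Resolve idq idqn idmn : core.

Lemma q_sub_m : q `<=` m.
Proof. by rewrite mE; apply: genS => z zs; rewrite in_cons zs orbT. Qed.

Lemma y_in_m : m y.
Proof. by rewrite mE; apply: gen_in; rewrite mem_head. Qed.

(** The powers 1, y, ..., y^(f-1) span R over the forms in xs. The powers of m and
    their intersections with powers of q are sums whose component along y^j runs
    over q^(e j), for a suitable e. *)
Definition slices e : set R := [set u | exists w : nat -> R,
  (forall j, (j < f)%N -> ideal_exp q (e j) (w j)) /\ u = \sum_(j < f) y ^+ j * w j].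

Lemma slices_ideal e : ideal (slices e).
Proof.
apply/idealP; split.
- exists (fun=> 0); split=> [j _|]; first exact: (ideal0 (idqn _)).
  by rewrite big1 // => j _; rewrite mulr0.
- move=> _ _ [w [wq ->]] [w' [wq' ->]]; exists (fun j => w j + w' j); split.
    by move=> j ltj; apply: (idealD (idqn _)); [apply: wq|apply: wq'].
  by rewrite -big_split; apply: eq_bigr => j _; rewrite mulrDr.
- move=> r _ [w [wq ->]]; exists (fun j => r * w j); split.
    by move=> j ltj; apply: (idealM (idqn _)); apply: wq.
  by rewrite mulr_sumr; apply: eq_bigr => j _; rewrite mulrCA.
Qed.

Lemma slices_mono e e' : (forall j, (j < f)%N -> (e' j <= e j)%N) -> slices e `<=` slices e'.
Proof.
move=> ee' _ [w [wq ->]]; exists w; split=> // j ltj.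
by apply: (ideal_exp_le idq (ee' j ltj)); apply: wq.
Qed.

Lemma slices_in e j w : (j < f)%N -> ideal_exp q (e j) w -> slices e (y ^+ j * w).
Proof.
move=> ltj qw; exists (fun i => if i == j then w else 0); split.
  by move=> i lti; case: eqP => [->//|_]; apply: (ideal0 (idqn _)).
rewrite (bigD1 (Ordinal ltj)) //= eqxx big1 ?addr0 // => i.
by rewrite -val_eqE /= => /negPf ->; rewrite mulr0.
Qed.

Lemma slices_mul e k b u : ideal_exp q k b -> slices e u -> slices (fun j => k + e j)%N (b * u).
Proof.
move=> qb [w [wq ->]]; rewrite mulr_sumr; apply: (ideal_sum (slices_ideal _)) => j _.
by rewrite mulrCA; apply: slices_in => //; apply: ideal_expM => //; apply: wq.
Qed.

Lemma slices_sub e k : (forall j, (j < f)%N -> (k <= e j)%N) -> slices e `<=` ideal_exp q k.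
Proof.
move=> ke _ [w [wq ->]]; apply: (ideal_sum (idqn _)) => j _.
by apply: (idealM (idqn _)); apply: (ideal_exp_le idq (ke j (ltn_ord j))); apply: wq.
Qed.

Lemma mexp_step i : ideal_exp m i `<=` slices (fun j => i - j)%N ->
  (forall w, ideal_exp q (i - f.-1) w -> slices (fun j => i.+1 - j)%N (y ^+ f * w)) ->
  ideal_exp m i.+1 `<=` slices (fun j => i.+1 - j)%N.
Proof.
move=> mi yf; rewrite ideal_expS; apply: ideal_mul_sub; first exact: slices_ideal.
move=> x u; rewrite {1}mE => /gen_cons_inP[r [b [qb ->]]] /mi Eu.
rewrite mulrDl; apply: (idealD (slices_ideal _)); last first.
  apply: (slices_mono (e := fun j => 1 + (i - j))%N); first by move=> j _; lia.
  by apply: slices_mul => //; rewrite ideal_exp1.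
rewrite -mulrA; apply: (idealM (slices_ideal _)).
case: Eu => w [wq ->]; rewrite mulr_sumr; apply: (ideal_sum (slices_ideal _)) => j _.
rewrite mulrA -exprS.
have [ltj|lef] := ltnP j.+1 f.
  by apply: slices_in => //=; rewrite subSS; apply: wq.
have jE : nat_of_ord j = f.-1 by have := ltn_ord j; lia.
have -> : j.+1 = f by rewrite jE prednK.
by apply: yf; rewrite -jE; apply: wq.
Qed.

Lemma mexp_small i : (i < f)%N -> ideal_exp m i `<=` slices (fun j => i - j)%N.
Proof.
elim: i => [_ u _|i IHi ltif].
  by rewrite -[u]mul1r -(expr0 y); apply: slices_in.
apply: mexp_step; first by apply: IHi; lia.
move=> w _; rewrite -(prednK f_gt0) exprSr -mulrA; apply: slices_in; first by lia.
by have -> : (i.+1 - f.-1 = 0)%N by lia.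
Qed.

Lemma yf_slices k w : ideal_exp q k w -> slices (fun j => f + k - j)%N (y ^+ f * w).
Proof.
move=> qw; have : ideal_mul q (ideal_exp m f.-1) (y ^+ f).
  by apply: reduction; apply: ideal_exp_in; apply: y_in_m.
have : ideal_mul q (ideal_exp m f.-1) `<=` slices (fun j => f - j)%N.
  apply: ideal_mul_sub; first exact: slices_ideal.
  move=> b u qb mu; apply: (slices_mono (e := fun j => 1 + (f.-1 - j))%N).
    by move=> j ltj; lia.
  apply: slices_mul; first by rewrite ideal_exp1.
  by apply: (mexp_small _ mu); rewrite prednK.
move=> /[apply] Ey; rewrite mulrC.
apply: (slices_mono (e := fun j => k + (f - j))%N); first by move=> j ltj; lia.
exact: slices_mul.
Qed.

Lemma mexp_slices i : ideal_exp m i `<=` slices (fun j => i - j)%N.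
Proof.
elim: i => [|i IHi]; first exact: mexp_small.
have [/mexp_small//|lefi] := ltnP i.+1 f.
apply: mexp_step => // w /yf_slices; apply: slices_mono => j ltj; lia.
Qed.

(** That is, (q : y^b) = q + (y^(f-b)): as long as the exponent of y is less than f,
    the cofactor is in m = q + (y), and can be divided by y modulo q. *)
Lemma uniserial (c : R) b : (b <= f)%N -> q (c * y ^+ b) -> exists c' : R, q (c - c' * y ^+ (f - b)).
Proof.
move=> ltbf qc.
have H k : (k + b <= f)%N -> exists c' : R, q (c - c' * y ^+ k).
  elim: k => [_|k IHk lek]; first by exists c; rewrite expr0 mulr1 subrr; apply: (ideal0 idq).
  have [|c' qc'] := IHk; first by lia.
  have mc' : m c'.
    apply: (@ypow _ (k + b)%N); first by lia.
    have -> : c' * y ^+ (k + b) = c * y ^+ b - (c - c' * y ^+ k) * y ^+ b.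
      by rewrite exprD; cring R.
    by apply: (idealB idq) => //; apply: (idealMr idq).
  move: mc'; rewrite mE => /gen_cons_inP[r [v [qv c'E]]]; exists r.
  have -> : c - r * y ^+ k.+1 = c - c' * y ^+ k + v * y ^+ k.
    by rewrite c'E exprS; cring R.
  by apply: (idealD idq) => //; apply: (idealMr idq).
by apply: H; lia.
Qed.

Lemma sum_split_power (b : nat) (w : nat -> R) : (b <= f)%N ->
  \sum_(j < f) y ^+ j * w j =
  \sum_(j < f | (j < b)%N) y ^+ j * w j + y ^+ b * \sum_(j < f | (b <= j)%N) y ^+ (j - b) * w j.
Proof.
move=> lebf; rewrite (bigID (fun j : 'I_f => (j < b)%N)) /=; congr (_ + _).
rewrite mulr_sumr; apply: eq_big => [j|j]; rewrite -leqNgt // => lebj.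
by rewrite mulrA -exprD subnKC.
Qed.

(** From a to a + 1, the components that are not in q^(a+1) form a product y^b w,
    with b = i - a and w in q^a. As this product is in q^(a+1), quasi-regularity
    and [uniserial] put the coefficients of w in q + (y^(f-b)), and y^f falls back
    into q m^(f-1). *)
Lemma mexp_qexp i a u : ideal_exp m i u -> ideal_exp q a u ->
  slices (fun j => maxn (i - j) a) u.
Proof.
elim: a => [|a IHa] mu qu.
  by move: (mexp_slices mu); apply: slices_mono => j _; rewrite maxn0.
have [leia|ltai] := leqP i a.
  have : slices (fun j => maxn (i - j) a.+1) (y ^+ 0 * u).
    by apply: slices_in => //; have -> : maxn (i - 0) a.+1 = a.+1 by lia.
  by rewrite expr0 mul1r.
have {IHa} := IHa mu (ideal_exp_le idq (leqnSn a) qu).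
have [lefia|ltiaf] := leqP f (i - a).
  by apply: slices_mono => j ltj; lia.
pose b := (i - a)%N; move=> [w [wq uE]].
rewrite (sum_split_power _ (b := b)) in uE; last by rewrite /b; lia.
set u1 := \sum_(j < f | _) _ in uE; set w1 := \sum_(j < f | _) _ in uE.
have Eu1 : slices (fun j => maxn (i - j) a.+1) u1.
  apply: (ideal_sum (slices_ideal _)) => j ltjb; apply: slices_in => //.
  have -> : maxn (i - j) a.+1 = maxn (i - j) a by rewrite /b in ltjb; lia.
  exact: wq.
have qw1 : ideal_exp q a w1.
  apply: (ideal_sum (idqn _)) => j lebj; apply: (idealM (idqn _)).
  by apply: (ideal_exp_le idq _ (wq j (ltn_ord j))); lia.
have qyw1 : ideal_exp q a.+1 (y ^+ b * w1).
  have -> : y ^+ b * w1 = u - u1 by rewrite uE; cring R.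
  by apply: (idealB (idqn _)) => //; apply: slices_sub Eu1 => j _; lia.
rewrite uE; apply: (idealD (slices_ideal _)) => //.
move: qw1 qyw1; rewrite {1}/q gen_mons => /genP[c w1E]; rewrite w1E -lincombZ => qyw1.
have cq k : (k < size (mons xs a))%N -> exists c' : R, q (c k - c' * y ^+ (f - b)).
  move=> ltk; apply: uniserial; first by rewrite /b; lia.
  by rewrite mulrC; apply: (quasi_regular rxs qyw1).
have /choice[c' c'E] : forall k, exists c' : R, (k < size (mons xs a))%N -> q (c k - c' * y ^+ (f - b)).
  move=> k; have [/cq[c' qc']|_] := ltnP k (size (mons xs a)); last by exists 0.
  by exists c'.
have -> : lincomb (fun k => y ^+ b * c k) (mons xs a) =
  y ^+ b * lincomb (fun k => c k - c' k * y ^+ (f - b)) (mons xs a) + y ^+ f * lincomb c' (mons xs a).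
  rewrite -[y ^+ f](_ : y ^+ (b + (f - b)) = _); last by rewrite subnKC //; rewrite /b; lia.
  rewrite exprD -mulrA -!lincombZ -lincombD; apply: eq_lincomb => k _; cring R.
apply: (idealD (slices_ideal _)).
  apply: slices_in; first by rewrite /b; lia.
  have -> : maxn (i - b) a.+1 = a.+1 by rewrite /b; lia.
  rewrite ideal_expS; apply: lincomb_ideal_mul => k ltk; first exact: c'E.
  by rewrite /q gen_mons; apply: gen_nth.
apply: (slices_mono (e := fun j => f + a - j)%N); first by move=> j ltj; lia.
by apply: yf_slices; rewrite /q gen_mons; apply: gen_lincomb.
Qed.

(** Monomials of degree i in y and xs that y^F does not divide. *)
Fixpoint staircase (F i : nat) : seq R :=
  if F is F'.+1 then
    staircase F' i ++ (if (F' <= i)%N then [seq y ^+ F' * t | t <- mons xs (i - F')] else [::])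
  else [::].

Lemma staircase_qexp F i x : x \in staircase F i -> ideal_exp q (i.+1 - F) x.
Proof.
elim: F => // F IHF; rewrite /= mem_cat => /orP[/IHF|].
  by apply: ideal_exp_le => //; lia.
case: ifP => // leFi /mapP[t tm ->]; apply: (idealM (idqn _)).
by rewrite subSS /q gen_mons; apply: gen_in.
Qed.

Lemma staircase_in F i x : x \in staircase F i -> ideal_exp m i x.
Proof.
elim: F => // F IHF; rewrite /= mem_cat => /orP[/IHF//|].
case: ifP => // leFi /mapP[t tm ->]; rewrite -(subnKC leFi).
apply: ideal_expM => //; first by apply: ideal_exp_in; apply: y_in_m.
by apply: (ideal_exp_sub q_sub_m); rewrite /q gen_mons; apply: gen_in.
Qed.

Lemma staircase_span i : gen (staircase f i) = ideal_exp m i.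
Proof.
apply/seteqP; split; first by apply: gen_sub => // x; apply: staircase_in.
move=> u /mexp_slices[w [wq ->]].
have blk F j : (j < F)%N -> (j <= i)%N -> forall v, ideal_exp q (i - j) v ->
    gen (staircase F i) (y ^+ j * v).
  elim: F => // F IHF ltjF leji v qv.
  have [ltj|leFj] := ltnP j F.
    have := IHF ltj leji v qv; apply: genS => x /= xf.
    by rewrite mem_cat xf.
  have jF : j = F by lia.
  move: qv; rewrite /q gen_mons => /genP[c ->]; rewrite -lincomb_map.
  suff : gen [seq y ^+ j * x | x <- mons xs (i - j)] `<=` gen (staircase F.+1 i).
    by apply; apply: gen_lincomb.
  by apply: genS => x xf; rewrite /= -jF leji mem_cat xf orbT.
apply: (ideal_sum (ideal_ideal_gen _)) => j _.
have [leji|ltij] := leqP j i; first by apply: blk => //; apply: wq.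
have -> : y ^+ j * w j = y ^+ i * (y ^+ (j - i) * w j).
  by rewrite mulrA -exprD subnKC // ltnW.
apply: blk => //; last by rewrite subnn.
by apply: ltn_trans ltij _.
Qed.

(** The monomials with the largest exponent F of y have the lowest degree a = i - F
    in xs. By [mexp_qexp], modulo q^(a+1) they only have to be compared with
    multiples of y^(F+1), and quasi-regularity shows that their coefficients are in
    m. They can thus be discarded, and F decreases. *)
Lemma staircase_indep i : indep m (ideal_exp m i.+1) (staircase f i).
Proof.
suff H F : (F <= f)%N -> indep m (ideal_exp m i.+1) (staircase F i) by apply: H.
elim: F => [|F IHF] leFf c; first by [].
rewrite [staircase _ _]/=; case: ifP => leFi; last by rewrite cats0; apply: IHF; lia.
rewrite lincomb_cat lincomb_map; set n := size _; set u := lincomb c _.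
set c' := fun j => c (n + j)%N; set w := lincomb c' _ => mc.
pose a := (i - F)%N.
have qw : ideal_exp q a w by rewrite /q gen_mons; apply: gen_lincomb.
have qu : ideal_exp q a.+1 u.
  apply: lincomb_ideal => // k ltk; have := staircase_qexp (mem_nth 0 ltk).
  by apply: ideal_exp_le => //; rewrite /a; lia.
have /(mexp_qexp mc)[v [vq vE]] : ideal_exp q a (u + y ^+ F * w).
  apply: (idealD (idqn _)); last exact: (idealM (idqn _)).
  exact: (ideal_exp_le idq (leqnSn a)).
rewrite (sum_split_power _ (b := F.+1)) // in vE.
set u1 := \sum_(j < f | _) _ in vE; set w1 := \sum_(j < f | _) _ in vE.
have qu1 : ideal_exp q a.+1 u1.
  apply: (ideal_sum (idqn _)) => j ltjb; apply: (idealM (idqn _)).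
  by apply: (ideal_exp_le idq _ (vq j (ltn_ord j))); rewrite /a; lia.
have qw1 : ideal_exp q a w1.
  apply: (ideal_sum (idqn _)) => j lebj; apply: (idealM (idqn _)).
  by apply: (ideal_exp_le idq _ (vq j (ltn_ord j))); lia.
have mc' k : (k < size (mons xs a))%N -> m (c' k).
  move=> ltk; move: qw1; rewrite {1}/q gen_mons => /genP[d w1E].
  have : ideal_exp q a.+1 (lincomb (fun k => y ^+ F * (c' k - y * d k)) (mons xs a)).
    have -> : lincomb (fun k => y ^+ F * (c' k - y * d k)) (mons xs a) = u1 - u.
      rewrite lincombZ lincombB lincombZ -w1E -/w.
      have -> : u1 - u = y ^+ F * w - y ^+ F.+1 * w1.
        by rewrite -[y ^+ F * w](addKr u) vE; cring R.
      by rewrite exprSr; cring R.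
    exact: (idealB (idqn _)).
  move=> /(quasi_regular rxs)/(_ k ltk); rewrite mulrC => /(ypow leFf) H.
  rewrite -(subrK (y * d k) (c' k)); apply: (idealD idm) => //.
  by apply: (idealMr idm); apply: y_in_m.
have mu : ideal_exp m i.+1 u.
  rewrite -(addrK (y ^+ F * w) u); apply: (idealB (idmn _)) => //.
  have -> : i.+1 = (F + a.+1)%N by rewrite /a; lia.
  apply: ideal_expM => //; first by apply: ideal_exp_in; apply: y_in_m.
  rewrite ideal_expS; apply: lincomb_ideal_mul => // k ltk.
  by apply: (ideal_exp_sub q_sub_m); rewrite /q gen_mons; apply: gen_nth.
move=> j; rewrite size_cat size_map => ltj.
have [ltjn|lenj] := ltnP j n; first by apply: (IHF (ltnW leFf) c mu).
by have := mc' (j - n)%N; rewrite /c' subnKC //; apply; rewrite /a; lia.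
Qed.

Lemma size_staircase F i : size (staircase F i) = (\sum_(j < F | (j <= i)%N) nmons (size xs) (i - j))%N.
Proof.
elim: F => [|F IHF]; first by rewrite big_ord0.
rewrite /= size_cat IHF big_mkcond [RHS]big_mkcond big_ord_recr /=; congr (_ + _)%N.
by case: ifP => // _; rewrite size_map size_mons.
Qed.

End Filtration.

(** * Reductions defined by points *)

Section Specialization.
Context {R : comNzRingType}.
Add Ring ring7 : (ring_axioms R).
Implicit Types (I J K B P Q : set R) (s : seq R) (x z u t w : R) (c : nat -> R).

Section Congruence.
Variables (m q : set R) (idm : ideal m) (idq : ideal q) (y : R) (my : m y).

(** Error terms for congruences of degree i modulo q: there are none in degree 0,
    where the only monomial is 1. *)
Definition reduced_power i : set R :=
  if i is i'.+1 then ideal_mul q (ideal_exp m i') else [set 0].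

Lemma reduced_power_ideal i : ideal (reduced_power i).
Proof. by case: i => [|i]; [exact: ideal_set0|exact: ideal_mul_ideal]. Qed.

Lemma reduced_power_mul i u : reduced_power i u -> reduced_power i.+1 (y * u).
Proof.
case: i => [->|i]; first by rewrite mulr0; apply: (ideal0 (ideal_mul_ideal _ _)).
rewrite /reduced_power ideal_expS ideal_mulA [ideal_mul q m]ideal_mulC -ideal_mulA.
exact: ideal_mul_in.
Qed.

Lemma mons_congr (g a : seq R) : size a = size g -> {in g, forall x, m x} ->
  (forall k, q (g`_k - a`_k * y)) ->
  forall i k, reduced_power i ((mons g i)`_k - y ^+ i * (mons a i)`_k).
Proof.
elim: g a => [|x g IHg] [|b a] // sza mg qga i k.
  case: i => [|i]; first by rewrite expr0 mul1r subrr.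
  rewrite !nth_nil mulr0 subrr; exact: (ideal0 (ideal_mul_ideal _ _)).
case: sza => sza.
have mg' : {in g, forall x, m x} by move=> z zg; apply: mg; rewrite in_cons zg orbT.
have {}IHg := IHg a sza mg' (fun k => qga k.+1).
elim: i k => [|i IHi] k; first by rewrite !mons0 mul1r subrr.
rewrite !mons_consS !nth_cat !size_map !size_mons ![size (_ :: _)]/= sza.
case: ifP => ltk; last exact: IHg.
rewrite !(nth_map 0) ?size_mons ?[size (_ :: _)]/= ?sza //.
set t := _`_k; set t' := _`_k; have IH : reduced_power i (t - y ^+ i * t') := IHi k.
have -> : x * t - y ^+ i.+1 * (b * t') = (x - b * y) * t + b * (y * (t - y ^+ i * t')).
  by rewrite exprS; cring R.
apply: (idealD (reduced_power_ideal _)).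
  apply: ideal_mul_in; first exact: (qga 0%N).
  by apply: (mons_ideal_exp idm mg); apply: mem_nth; rewrite size_mons.
by apply: (idealM (reduced_power_ideal _)); apply: reduced_power_mul.
Qed.

End Congruence.

Lemma gen_rem0 s : gen (rem 0 s) = gen s.
Proof.
apply/seteqP; split; first by apply: genS => x /mem_rem.
apply: gen_subl => x xs; have [->|x0] := eqVneq x 0.
  exact: (ideal0 (ideal_ideal_gen _)).
apply: gen_in; have [s0|s0] := boolP (0 \in s); last by rewrite rem_id.
by move: xs; rewrite (perm_mem (perm_to_rem s0)) in_cons (negPf x0).
Qed.

(** With y = g_l, the linear forms g_k - a_k y vanish at a. Modulo q m^(f-1), the
    form is y^f times its value at a, so y^f is in q m^(f-1) + m^(f+1), and
    Nakayama's lemma removes the second term. *)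
Lemma point_reduction m (g a : seq R) l f c :
  noetherian R -> in_jacobson m -> m = gen g -> size a = size g -> (l < size g)%N ->
  a`_l = 1 -> (0 < f)%N -> ideal_exp m f.+1 (lincomb c (mons g f)) ->
  (exists z, lincomb c (mons a f) * z = 1) ->
  exists xs, [/\ size xs = (size g).-1, m = gen (g`_l :: xs) &
    ideal_exp m f `<=` ideal_mul (gen xs) (ideal_exp m f.-1)].
Proof.
move=> noeth jm mE sza ltl al f_gt0 Fg [z Fa]; have [idm _] := jm.
set y := g`_l; pose ys := [seq g`_k - a`_k * y | k <- iota 0 (size g)].
have ys0 : 0 \in ys.
  by apply/mapP; exists l; rewrite ?mem_iota // al mul1r subrr.
exists (rem 0 ys); rewrite gen_rem0.
have my : m y by rewrite mE; apply: gen_nth.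
have mg : {in g, forall x, m x} by move=> x xg; rewrite mE; apply: gen_in.
have ysk k : gen ys (g`_k - a`_k * y).
  have [ltk|lek] := ltnP k (size g).
    by apply: gen_in; apply/mapP; exists k; rewrite ?mem_iota.
  rewrite !nth_default ?sza // mul0r subrr; exact: (ideal0 (ideal_ideal_gen _)).
have subm : gen ys `<=` m.
  by apply: gen_sub => // x /mapP[k _ ->]; apply: (idealB idm);
    [rewrite mE; apply: gen_nth|apply: (idealM idm)].
have mE' : m = gen (y :: rem 0 ys).
  apply/seteqP; split; last first.
    apply: gen_sub => // x; rewrite in_cons => /orP[/eqP ->//|/gen_in].
    by rewrite gen_rem0; apply: subm.
  rewrite {1}mE; apply: gen_subl => x xg; apply/gen_cons_inP.
  exists a`_(index x g), (x - a`_(index x g) * y); split; last by cring R.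
  by rewrite gen_rem0; have := ysk (index x g); rewrite nth_index.
split=> //; first by rewrite size_rem // size_map size_iota.
set q := gen ys.
apply: (nakayama_ideal noeth jm) => //.
have Eq : q = gen (rem 0 ys) by rewrite gen_rem0.
have yf : ideal_add (ideal_mul q (ideal_exp m f.-1)) (ideal_mul m (ideal_exp m f)) (y ^+ f).
  exists (- z * (lincomb c (mons g f) - y ^+ f * lincomb c (mons a f))), (z * lincomb c (mons g f)); split.
  - apply: (idealM (ideal_mul_ideal _ _)).
    have -> : y ^+ f * lincomb c (mons a f) = lincomb c [seq y ^+ f * x | x <- mons a f] by rewrite lincomb_map.
    have szE : size (mons a f) = size (mons g f) by rewrite !size_mons sza.
    rewrite /lincomb size_map szE -sumrB; apply: (ideal_sum (ideal_mul_ideal _ _)) => k _.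
    rewrite (nth_map 0) ?szE // -mulrBr; apply: (idealM (ideal_mul_ideal _ _)).
    have := mons_congr idm my sza mg ysk f k.
    by rewrite -{1}(prednK f_gt0).
  - exact: (idealM (ideal_mul_ideal _ _)).
  - by rewrite -[LHS]mulr1 -Fa; cring R.
have idsum : ideal (ideal_add (ideal_mul q (ideal_exp m f.-1)) (ideal_mul m (ideal_exp m f))).
  exact: ideal_add_ideal.
rewrite {1}mE' gen_mons; apply: gen_sub => // x.
rewrite mons_head in_cons => /orP[/eqP ->//|].
rewrite -(prednK f_gt0) => /behead_mons_in qx.
exists x, 0; rewrite addr0; split=> //; last exact: (ideal0 (ideal_mul_ideal _ _)).
by rewrite Eq mE' prednK.
Qed.

End Specialization.

(** * Kronecker substitution *)

Section Kronecker.

Fixpoint exponents_cons (w : nat) (es : nat -> seq nat) (i : nat) : seq nat :=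
  if i is i'.+1 then [seq (w + e)%N | e <- exponents_cons w es i'] ++ es i else es 0%N.

Fixpoint exponents (ws : seq nat) (i : nat) : seq nat :=
  if ws is w :: ws' then exponents_cons w (exponents ws') i else
  if i is 0 then [:: 0%N] else [::].

Lemma exponents_consS w ws i :
  exponents (w :: ws) i.+1 = [seq (w + e)%N | e <- exponents (w :: ws) i] ++ exponents ws i.+1.
Proof. by []. Qed.

Lemma mons_pow (R : comNzRingType) (x : R) ws i :
  mons [seq x ^+ w | w <- ws] i = [seq x ^+ e | e <- exponents ws i].
Proof.
elim: ws i => [|w ws IHws] [|i] //; first exact: (IHws 0%N).
elim: i => [|i IHi]; rewrite [LHS]mons_consS exponents_consS map_cat -IHws; congr (_ ++ _).
  rewrite -map_comp [mons _ 0](IHws 0%N) -map_comp; apply: eq_map => e /=.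
  by rewrite exprD.
by rewrite IHi -!map_comp; apply: eq_map => e /=; rewrite exprD.
Qed.

(** Each weight exceeds f times the sum of the next ones, so that the monomials of
    degree at most f in the variables X^w have distinct exponents. The last weight
    is 0: one coordinate of the point is 1, as in [point_reduction]. *)
Fixpoint kronecker_weights (f n : nat) : seq nat :=
  if n is n'.+1 then (f * sumn (kronecker_weights f n')).+1 :: kronecker_weights f n' else [:: 0%N].

Lemma size_kronecker_weights f n : size (kronecker_weights f n) = n.+1.
Proof. by elim: n => //= n ->. Qed.

Lemma exponents_bound ws i e : e \in exponents ws i -> (e <= i * sumn ws)%N.
Proof.
elim: ws i e => [|w ws IHws] [|i] e //=; try by rewrite inE => /eqP ->.
  by move=> /IHws; rewrite !mul0n.
rewrite -[_ ++ _]/(exponents (w :: ws) i.+1).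
elim: i e => [|i IHi] e; rewrite exponents_consS mem_cat => /orP[/mapP[e' e'm ->]|/IHws].
- by have := IHws 0%N e' e'm; lia.
- by lia.
- by have := IHi e' e'm; lia.
- by lia.
Qed.

Lemma uniq_exponents_kronecker f n i : (i <= f)%N -> uniq (exponents (kronecker_weights f n) i).
Proof.
elim: n i => [|n IHn] i leif.
  have E j : exponents [:: 0%N] j = [:: 0%N].
    by elim: j => [//|j IHj]; rewrite exponents_consS IHj.
  by rewrite E.
elim: i leif => [_|i IHi leif]; first exact: (IHn 0%N).
rewrite [kronecker_weights _ _]/= exponents_consS cat_uniq IHn // andbT.
rewrite map_inj_uniq; last by move=> a b /addnI.
rewrite [uniq _]IHi ?(ltnW leif) //=; apply/hasPn => e /exponents_bound leE.
apply/negP => /mapP[e' _ eE]; rewrite eE in leE.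
by have := leq_mul2r (sumn (kronecker_weights f n)) i.+1 f; rewrite leif orbT => H; lia.
Qed.

Lemma lead_coef_sparse (R : comNzRingType) (es : seq nat) (c : nat -> R) j :
  uniq es -> (j < size es)%N -> c j != 0 ->
  exists2 k, c k != 0 & lead_coef (\sum_(i < size es) (c i)%:P * 'X^(nth 0%N es i)) = c k.
Proof.
move=> ues ltj cj; set p := \sum_(i < _) _.
have coefE e : p`_e = if e \in es then c (index e es) else 0.
  rewrite coef_sum; case: ifP => [ees|ees].
    rewrite -index_mem in ees; rewrite (bigD1 (Ordinal ees)) //= coefCM coefXn.
    rewrite nth_index -?index_mem // eqxx mulr1 big1 ?addr0 // => i nei.
    rewrite coefCM coefXn; case: eqP => [eE|]; last by rewrite mulr0.
    by case/eqP: nei; apply: val_inj; rewrite /= eE index_uniq.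
  rewrite big1 // => i _; rewrite coefCM coefXn; case: eqP => [eE|]; last by rewrite mulr0.
  by move: ees; rewrite eE mem_nth.
have p0 : p != 0.
  apply: contraNneq cj => p0; have := coefE (nth 0%N es j).
  by rewrite mem_nth // index_uniq // p0 coef0 => <-.
move: p0; rewrite -lead_coef_eq0 lead_coefE coefE.
by case: ifP => _; rewrite ?eqxx // => ck; exists (index (size p).-1 es).
Qed.

End Kronecker.

(** * Base change along a free extension *)

Section BaseChange.
Context {R A : comNzRingType}.
Add Ring ring8 : (ring_axioms R).
Add Ring ring9 : (ring_axioms A).
Variables (iota : {rmorphism R -> A}) (X : A) (D : nat) (coord : A -> nat -> R).
Hypotheses (D_gt0 : (0 < D)%N)
  (coord_sum : forall u, u = \sum_(t < D) iota (coord u t) * X ^+ t)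
  (coordD : forall u v t, coord (u + v) t = coord u t + coord v t)
  (coordZ : forall r u t, coord (iota r * u) t = r * coord u t)
  (coordX : forall i j, (i < D)%N -> (j < D)%N -> coord (X ^+ i) j = (i == j)%:R).
Implicit Types (I K B m : set R).

(** The extension of an ideal, described on coordinates in the power basis. *)
Definition ext I : set A := [set u | forall t, (t < D)%N -> I (coord u t)].

Lemma coord0 t : coord 0 t = 0.
Proof. by rewrite -(mul0r (0 : A)) -(rmorph0 iota) coordZ mul0r. Qed.

Lemma coord_bigsum (T : Type) (r : seq T) (P : pred T) (F : T -> A) t :
  coord (\sum_(i <- r | P i) F i) t = \sum_(i <- r | P i) coord (F i) t.
Proof.
by elim/big_rec2: _ => [|i x y _ <-]; rewrite ?coord0 ?coordD.
Qed.

Lemma ext_ideal I : ideal I -> ideal (ext I).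
Proof.
move=> idI; apply/idealP; split.
- by move=> t _; rewrite coord0; apply: (ideal0 idI).
- by move=> u v Iu Iv t ltt; rewrite coordD; apply: (idealD idI); [apply: Iu|apply: Iv].
- move=> r u Iu t ltt; rewrite (coord_sum u) mulr_sumr coord_bigsum.
  apply: (ideal_sum idI) => j _; rewrite mulrCA coordZ.
  by apply: (idealMr idI); apply: Iu.
Qed.

Lemma ext_iota I r : ideal I -> I r -> ext I (iota r).
Proof.
by move=> idI Ir t _; rewrite -[iota r]mulr1 coordZ; apply: (idealMr idI).
Qed.

Lemma iota_lincomb c s : iota (lincomb c s) = lincomb (fun i => iota (c i)) [seq iota x | x <- s].
Proof.
rewrite /lincomb rmorph_sum size_map; apply: eq_bigr => i _.
by rewrite rmorphM /= (nth_map 0).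
Qed.

Lemma ext_gen s : ext (gen s) = gen [seq iota x | x <- s].
Proof.
apply/seteqP; split; last first.
  apply: gen_sub; first exact: ext_ideal.
  by move=> _ /mapP[x xs ->]; apply: ext_iota => //; apply: gen_in.
move=> u gu; rewrite (coord_sum u); apply: (ideal_sum (ideal_ideal_gen _)) => t _.
apply: (idealMr (ideal_ideal_gen _)); have /genP[c ->] := gu t (ltn_ord t).
by rewrite iota_lincomb; apply: gen_lincomb.
Qed.

Lemma map_mons s i : [seq iota x | x <- mons s i] = mons [seq iota x | x <- s] i.
Proof.
elim: s i => [|x s IHs] [|i] //; rewrite ?mons0 /= ?rmorph1 //.
rewrite -[_ ++ _]/(mons (x :: s) i.+1) -[RHS]/(mons (iota x :: [seq iota x | x <- s]) i.+1).
elim: i => [|i IHi]; rewrite mons_consS [RHS]mons_consS map_cat IHs; congr (_ ++ _).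
  by rewrite !mons0 /= rmorphM rmorph1.
by rewrite -IHi -!map_comp; apply: eq_map => z /=; rewrite rmorphM.
Qed.

Lemma ext_exp (g : seq R) i : ideal_exp (ext (gen g)) i = ext (ideal_exp (gen g) i).
Proof. by rewrite gen_mons !ext_gen gen_mons map_mons. Qed.

Lemma ext_indep m K v : indep m K v -> indep (ext m) (ext K) [seq iota x | x <- v].
Proof.
move=> vi c Kc j; rewrite size_map => ltj t ltt.
apply: (vi (fun i => coord (c i) t)) => //; have := Kc t ltt; rewrite /lincomb size_map coord_bigsum.
congr K; apply: eq_bigr => i _; by rewrite (nth_map 0) // mulrC coordZ mulrC.
Qed.

Lemma ext_nzd B z : nzd B z -> nzd (ext B) (iota z).
Proof. by move=> Bz a Ba t ltt; apply: Bz; rewrite -coordZ; apply: Ba. Qed.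

Lemma ext_ideal_addp B z : ideal B -> ext (ideal_addp B z) = ideal_addp (ext B) (iota z).
Proof.
move=> idB; apply/seteqP; split; last first.
  apply: ideal_addp_min; first by apply: ext_ideal; apply: ideal_addp_ideal.
    by move=> u Bu t ltt; apply: ideal_addp_sub; apply: Bu.
  by apply: ext_iota; [exact: ideal_addp_ideal|exact: ideal_addp_in].
move=> u Bu; rewrite (coord_sum u).
have idE : ideal (ideal_addp (ext B) (iota z)) by apply: ideal_addp_ideal; apply: ext_ideal.
apply: (ideal_sum idE) => t _; apply: (idealMr idE).
have [b [r [Bb ->]]] := Bu t (ltn_ord t); exists (iota b), (iota r).
by rewrite rmorphD rmorphM; split=> //; apply: ext_iota.
Qed.

Lemma ext_depth_ge m B d : ideal m -> ideal B -> depth_ge m B d -> depth_ge (ext m) (ext B) d.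
Proof.
move=> idm; elim: d B => //= d IHd B idB [z [mz Bz depz]]; exists (iota z).
split; [exact: ext_iota|exact: ext_nzd|rewrite -ext_ideal_addp //].
by apply: IHd => //; apply: ideal_addp_ideal.
Qed.

Lemma ext_set0 : ext [set 0] = [set 0].
Proof.
apply/seteqP; split=> [u u0|_ ->]; last by move=> t _; rewrite coord0.
by rewrite /= (coord_sum u) big1 // => t _; rewrite u0 // rmorph0 mul0r.
Qed.

(** The matrix of the multiplication by 1 + u is congruent to 1 modulo m, hence
    invertible, so that 1 is a multiple of 1 + u. *)
Lemma ext_in_jacobson m : in_jacobson m -> in_jacobson (ext m).
Proof.
move=> jm; have [idm _] := jm; split; first exact: ext_ideal.
move=> u mu; pose M : 'M[R]_D := \matrix_(i, j) coord ((1 + u) * X ^+ i) j.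
have [y yE] : exists y, \det M * y = 1.
  apply: (det_unit jm) => i j; rewrite mxE mulrDl mul1r coordD coordX // addrAC subrr add0r.
  by apply: (idealMr (ext_ideal idm)) => //; apply: mu.
pose N : 'M[R]_D := y *: \adj M.
have NM : N *m M = 1%:M by rewrite -scalemxAl mul_adj_mx scale_scalar_mx mulrC yE.
exists (\sum_(i < D) iota (N (Ordinal D_gt0) i) * X ^+ i).
rewrite mulr_sumr.
have H i : (1 + u) * X ^+ i = \sum_(j < D) iota (coord ((1 + u) * X ^+ i) j) * X ^+ j.
  exact: coord_sum.
under eq_bigr do rewrite mulrCA H mulr_sumr.
rewrite exchange_big /= (bigD1 (Ordinal D_gt0)) //= [X in _ + X]big1 => [|j j0].
  rewrite addr0 -[RHS](rmorph1 iota); under eq_bigr do rewrite expr0 mulr1 -rmorphM.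
  rewrite -rmorph_sum; congr (iota _).
  transitivity ((N *m M) (Ordinal D_gt0) (Ordinal D_gt0)); last by rewrite NM mxE eqxx.
  by rewrite mxE; apply: eq_bigr => i _; rewrite [M _ _]mxE.
under eq_bigr do rewrite mulrA -rmorphM.
rewrite -mulr_suml -rmorph_sum.
rewrite [X in iota X](_ : _ = 0) ?rmorph0 ?mul0r //.
transitivity ((N *m M) (Ordinal D_gt0) j); last by rewrite NM mxE eq_sym (negPf j0).
by rewrite mxE; apply: eq_bigr => i _; rewrite [M _ _]mxE.
Qed.

(** Hilbert's argument, where the last nonzero coordinate plays the part of the
    leading coefficient. *)
Lemma ext_noetherian : noetherian R -> noetherian A.
Proof.
move=> noeth I idI.
have H k : (k <= D)%N -> exists s : seq A, {in s, forall x, I x} /\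
    forall u, I u -> (forall j, (k <= j < D)%N -> coord u j = 0) -> gen s u.
  elim: k => [_|k IHk ltkD].
    exists [::]; split=> // u _ u0; rewrite gen_nil /= (coord_sum u) big1 // => t _.
    by rewrite u0 ?rmorph0 ?mul0r ?ltn_ord.
  have [s [sI sP]] := IHk (ltnW ltkD).
  pose L := [set r | exists u, [/\ I u, coord u k = r & forall j, (k < j < D)%N -> coord u j = 0]].
  have idL : ideal L.
    apply/idealP; split.
    - by exists 0; split; rewrite ?coord0 //; first exact: (ideal0 idI); move=> j _; rewrite coord0.
    - move=> _ _ [u [Iu <- u0]] [v [Iv <- v0]]; exists (u + v); split.
      + exact: (idealD idI).
      + by rewrite coordD.
      + by move=> j ltj; rewrite coordD u0 // v0 // addr0.
    - move=> r _ [u [Iu <- u0]]; exists (iota r * u); split.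
      + exact: (idealM idI).
      + by rewrite coordZ.
      + by move=> j ltj; rewrite coordZ u0 // mulr0.
  have [l lL] := noeth L idL.
  have /choice[h hP] : forall r, exists u, L r ->
      [/\ I u, coord u k = r & forall j, (k < j < D)%N -> coord u j = 0].
    move=> r; have [[u Pu]|nL] := pselect (L r); first by exists u.
    by exists 0 => /nL.
  have lI r : r \in l -> L r by move=> rl; rewrite -lL; apply: gen_in.
  exists ([seq h r | r <- l] ++ s); split.
    move=> x; rewrite mem_cat => /orP[/mapP[r rl ->]|/sI//].
    by have [] := hP r (lI r rl).
  move=> u Iu u0; have : L (coord u k) by exists u; split.
  rewrite -lL => /genP[c cE].
  pose v := lincomb (fun i => iota (c i)) [seq h r | r <- l].
  have gv : gen [seq h r | r <- l] v by apply: gen_lincomb.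
  have coordv j : coord v j = \sum_(i < size l) c i * coord (h l`_i) j.
    rewrite /v /lincomb size_map coord_bigsum; apply: eq_bigr => i _.
    by rewrite coordZ (nth_map 0).
  have Lnth i : (i < size l)%N -> L l`_i by move=> lti; apply: lI; apply: mem_nth.
  apply/gen_cat_inP; exists v, (u - v); split=> //; last by cring A.
  apply: sP.
    apply: (idealB idI) => //; rewrite /v; apply: lincomb_ideal => // i; rewrite size_map => lti.
    by rewrite (nth_map 0) //; have [] := hP _ (Lnth _ lti).
  move=> j /andP[lekj ltjD]; rewrite -mulN1r -(rmorph1 iota) -rmorphN coordD coordZ mulN1r.
  move: lekj; rewrite leq_eqVlt => /orP[/eqP <-|ltkj].
    rewrite cE coordv; apply/eqP; rewrite subr_eq0; apply/eqP; apply: eq_bigr => i _.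
    by have [_ -> _] := hP _ (Lnth _ (ltn_ord i)).
  rewrite u0 ?ltkj // coordv big1 ?subr0 // => i _.
  by have [_ _ ->] := hP _ (Lnth _ (ltn_ord i)); rewrite ?mulr0 // ltkj.
have [s [sI sP]] := H D (leqnn _).
exists s; apply/seteqP; split; first exact: gen_sub.
by move=> u Iu; apply: sP => // j /andP[]; lia.
Qed.

End BaseChange.

(** * The Hilbert function *)

(** The extension is R[X]/(X g - 1), the polynomial being made monic by y. It
    provides points where a form has a unit value, even if the residue field is too
    small to contain one. *)
Lemma inverting_extension (R : comNzRingType) (g : {poly R}) (y : R) :
  lead_coef g * y = 1 ->
  exists (A : comNzRingType) (iota : {rmorphism R -> A}) (ev : {rmorphism {poly R} -> A})
    (D : nat) (coord : A -> nat -> R),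
  [/\ (0 < D)%N,
      forall u, u = \sum_(t < D) iota (coord u t) * ev 'X ^+ t,
      forall u v t, coord (u + v) t = coord u t + coord v t,
      forall r u t, coord (iota r * u) t = r * coord u t
    & forall i j, (i < D)%N -> (j < D)%N -> coord (ev 'X ^+ i) j = (i == j)%:R]
  /\ (forall c, ev c%:P = iota c) /\ exists z, ev g * z = 1.
Proof.
move=> gy.
have g0 : g != 0.
  by apply/eqP => g0; move: gy; rewrite g0 lead_coef0 mul0r => /eqP; rewrite eq_sym oner_eq0.
pose k : {poly R} := g * 'X - 1.
have szX : size (g * 'X) = (size g).+1 by rewrite size_mulX.
have szg : (0 < size g)%N by rewrite size_poly_gt0.
have lt1 : (size (- 1 : {poly R})%R < size (g * 'X)%R)%N.
  by rewrite size_polyN size_poly1 szX.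
have lk : lead_coef k = lead_coef g by rewrite /k lead_coefDl // lead_coefMX.
have szk : size k = (size g).+1 by rewrite /k size_polyDl.
pose p := y%:P * k.
have ylk : lead_coef (y%:P : {poly R}) * lead_coef k = 1 by rewrite lead_coefC lk mulrC.
have mp : p \is monic by rewrite monicE /p lead_coef_proper_mul ylk // oner_neq0.
have szp : (1 < size p)%N.
  rewrite /p size_proper_mul ?ylk ?oner_neq0 // szk size_polyC.
  by case: eqP gy => [-> /eqP|_ _]; rewrite ?mulr0 1?eq_sym ?oner_eq0 //=; lia.
have mkp : mk_monic p = p by rewrite /mk_monic szp mp.
have small (u : {poly %/ p}) : (size (u : {poly R}) < size p)%N.
  by apply: leq_trans (size_mk_monic u) _; rewrite mkp.
have evC c : in_qpoly p c%:P = qpolyC p c.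
  apply: val_inj; rewrite /= mkp Pdiv.CommonRing.rmodp_small // size_polyC.
  by apply: leq_ltn_trans szp; case: eqP.
have evX i : (i < (size p).-1)%N -> ((in_qpoly p 'X) ^+ i : {poly %/ p}) = 'X^i :> {poly R}.
  by move=> lti; rewrite -rmorphXn /= mkp Pdiv.CommonRing.rmodp_small // size_polyXn -ltn_predRL.
have evM r i : (i < (size p).-1)%N ->
    (qpolyC p r * in_qpoly p 'X ^+ i : {poly %/ p}) = r%:P * 'X^i :> {poly R}.
  move=> lti; rewrite -evC -rmorphXn -rmorphM /= mkp Pdiv.CommonRing.rmodp_small //.
  rewrite mul_polyC; apply: leq_ltn_trans (size_scale_leq _ _) _.
  by rewrite size_polyXn -ltn_predRL.
exists ({poly %/ p} : comNzRingType), (qpolyC p : {rmorphism R -> {poly %/ p}}),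
  (in_qpoly p : {rmorphism {poly R} -> {poly %/ p}}), (size p).-1,
  (fun (u : {poly %/ p}) t => (u : {poly R})`_t).
split; first split.
- by rewrite ltn_predRL.
- move=> u; apply: val_inj; rewrite [RHS]poly_of_qpoly_sum.
  apply/polyP => i; rewrite coef_sum.
  under eq_bigr => t _ do rewrite evM // coefCM coefXn.
  have [lti|lei] := ltnP i (size p).-1.
    rewrite (bigD1 (Ordinal lti)) //= eqxx mulr1 big1 ?addr0 // => t.
    by rewrite -val_eqE /= eq_sym => /negPf ->; rewrite mulr0.
  rewrite big1 => [|t _]; first by rewrite nth_default // -ltnS (leq_trans (small u)) // -(prednK (ltnW szp)) ltnS.
  by case: eqP => [E|]; rewrite ?mulr0 //; move: (ltn_ord t); rewrite -E ltnNge lei.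
- by move=> u v t; rewrite /= coefD.
- move=> r u t; rewrite /= Pdiv.CommonRing.rmodp_small ?coefCM // mul_polyC.
  exact: leq_ltn_trans (size_scale_leq _ _) (size_mk_monic u).
- by move=> i j lti ltj; rewrite evX // coefXn eq_sym.
split=> //; exists (in_qpoly p 'X).
have : in_qpoly p p = 0 by apply: val_inj; rewrite /= mkp Pdiv.RingMonic.rmodpp.
rewrite /p rmorphM /= => pk0.
have : in_qpoly p k = 0.
  rewrite -[LHS]mul1r -(rmorph1 (in_qpoly p)) -polyC1 -gy polyCM rmorphM -mulrA.
  by rewrite [_ * in_qpoly p k]pk0 mulr0.
rewrite /k rmorphB rmorphM rmorph1 => /eqP; rewrite subr_eq0 => /eqP ->.
by [].
Qed.

(** The point of coordinates X^w, for Kronecker weights w, gives the leading form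
    the value G, which the base change makes invertible. The monomials of
    [staircase] are then a basis of m^i/m^(i+1) over the extension, and so are the
    images of v. *)
Theorem hilbert_function (R : comNzRingType) (m : set R) (g : seq R) (f d : nat)
    (c : nat -> R) (k : nat) :
  noetherian R -> in_jacobson m -> (forall x, ~ m x -> exists y, x * y = 1) ->
  m = gen g -> size g = d.+1 -> depth_ge m [set 0] d -> (0 < f)%N ->
  (forall i, (i < f)%N -> indep m (ideal_exp m i.+1) (mons g i)) ->
  ideal_exp m f.+1 (lincomb c (mons g f)) -> (k < size (mons g f))%N -> ~ m (c k) ->
  forall i (v : seq R), gen v = ideal_exp m i -> indep m (ideal_exp m i.+1) v ->
  size v = (\sum_(j < f | (j <= i)%N) nmons d (i - j))%N.
Proof.
move=> noeth jm unitm mE szg depm f_gt0 norel rel ltk nmck i v vE vi.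
have [idm _] := jm.
(* Without its coefficients in m, the relation has unit coefficients only. *)
pose c' j := if `[< m (c j) >] then 0 else c j.
have rel' : ideal_exp m f.+1 (lincomb c' (mons g f)).
  have -> : lincomb c' (mons g f) = lincomb c (mons g f) - lincomb (fun j => c j - c' j) (mons g f).
    by rewrite lincombB opprB addrC subrK.
  apply: (idealB (ideal_exp_ideal _ _)) => //; rewrite ideal_expS.
  apply: lincomb_ideal_mul => j ltj; last by rewrite mE gen_mons; apply: gen_nth.
  by rewrite /c'; case: asboolP => [mcj|_]; rewrite ?subr0 // subrr; apply: (ideal0 idm).
have c'k : c' k != 0.
  rewrite /c'; case: asboolP => // _; apply/eqP => ck0; apply: nmck; rewrite ck0.
  exact: (ideal0 idm).
have c'u j : c' j != 0 -> exists y, c' j * y = 1.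
  by rewrite /c'; case: asboolP => [_|nm _]; [rewrite eqxx|apply: unitm].
pose ws := kronecker_weights f d; pose es := exponents ws f.
have szws : size ws = size g by rewrite size_kronecker_weights szg.
have szes (A : comNzRingType) (x : A) : size (mons g f) = size es.
  have := congr1 size (mons_pow x ws f); rewrite !size_map -/es => <-.
  by rewrite !size_mons size_map szws.
pose G := \sum_(j < size es) (c' j)%:P * 'X^(nth 0%N es j).
have [|j0 c'j0 lG] := @lead_coef_sparse R es c' k (uniq_exponents_kronecker _ (leqnn f)) _ c'k.
  by rewrite -(szes R 1).
have [y yE] := c'u j0 c'j0.
have [|A [iota [ev [D [coord [[D_gt0 c_sum cD cZ cX] [evC [z evG]]]]]]]] :=
  @inverting_extension R G y; first by rewrite /G lG.
pose mA := ext D coord m; pose gA := [seq iota x | x <- g].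
have mAE : mA = gen gA by rewrite /mA mE (ext_gen c_sum cD cZ).
have idmA : ideal mA by rewrite mAE.
have jmA : in_jacobson mA by apply: (ext_in_jacobson D_gt0 c_sum cD cZ cX).
have noethA : noetherian A := ext_noetherian D_gt0 c_sum cD cZ noeth.
have expA j : ideal_exp mA j = ext D coord (ideal_exp m j).
  by rewrite /mA mE (ext_exp c_sum cD cZ).
pose a := [seq (ev 'X) ^+ w | w <- ws].
have sza : size a = size gA by rewrite !size_map.
have ltd : (d < size gA)%N by rewrite size_map szg.
have relA : ideal_exp mA f.+1 (lincomb (iota \o c') (mons gA f)).
  rewrite -map_mons -iota_lincomb expA; exact: (ext_iota cZ).
have [||xs [szxs mxs red]] :=
    @point_reduction A mA gA a d f (iota \o c') noethA jmA mAE sza ltd _ f_gt0 relA _.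
- rewrite (nth_map 0%N) ?size_kronecker_weights //.
  have -> : nth 0%N ws d = 0%N by rewrite /ws; elim: (d) => //=.
  by rewrite expr0.
- exists z; rewrite -[RHS]evG; congr (_ * _).
  rewrite mons_pow -/es /lincomb size_map rmorph_sum; apply: eq_bigr => j _.
  by rewrite rmorphM rmorphXn /= evC (nth_map 0%N).
rewrite size_map szg /= in szxs.
have depA : depth_ge mA [set 0] (size xs + 0).
  rewrite szxs addn0 -(ext_set0 c_sum cZ).
  exact: (ext_depth_ge c_sum cD cZ).
have mxs' : {in xs, forall x, mA x}.
  by move=> x xx; rewrite mxs; apply: gen_in; rewrite in_cons xx orbT.
have [|rs [szrs _ rrs grs _]] :=
    regular_generators (b := f) noethA jmA (@ideal_set0 A) mxs' _ depA.
  by rewrite ideal_addl0; apply: (subset_trans red); apply: ideal_mul_subl.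
rewrite !ideal_addl0 in grs.
have /regular_over_rev {}rrs := rrs; set r := rev rs in rrs.
have gr : gen r = gen xs by rewrite gen_rev.
set ya := gA`_d in mxs.
have mr : mA = gen (ya :: r).
  rewrite mxs; apply/seteqP; split=> u /gen_cons_inP[b [w [gw ->]]];
  by apply/gen_cons_inP; exists b, w; rewrite ?gr // -gr.
have szr : size r = d by rewrite size_rev szrs szxs.
have norelA j : (j < f)%N -> indep mA (ideal_exp mA j.+1) (mons (ya :: r) j).
  move=> ltj; apply: (spanning_indep jmA (ideal_exp_ideal _ _) (v := mons gA j)).
  - by rewrite -!gen_mons -mr -mAE.
  - rewrite /gA -map_mons expA; apply: (ext_indep cD cZ).
    exact: norel.
  - by rewrite !size_mons size_map /= szg szr.
have ypow := powers_indep idmA mr norelA.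
rewrite -gr in red.
have span := staircase_span idmA f_gt0 mr red i.
have famI : indep mA (ideal_exp mA i.+1) (staircase ya r f i).
  exact: (staircase_indep idmA f_gt0 mr rrs red ypow).
have vAI : indep mA (ideal_exp mA i.+1) [seq iota x | x <- v].
  by rewrite expA; apply: (ext_indep cD cZ).
have vAE : gen [seq iota x | x <- v] = ideal_exp mA i.
  by rewrite expA -vE (ext_gen c_sum cD cZ).
rewrite -szr -(size_staircase ya r f i) -(size_map iota v).
apply/eqP; rewrite eqn_leq; apply/andP; split.
  by apply: (indep_size_le jmA (ideal_exp_ideal mA i.+1)) => //; rewrite vAE.
by apply: (indep_size_le jmA (ideal_exp_ideal mA i.+1)) => //; rewrite vAE.
Qed.

(** * Minima and maxima of sets of natural numbers *)

Section Extrema.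
Implicit Type A : set nat.

Lemma infimum_nat A : A !=set0 ->
  A (infimum 0%N A) /\ forall n, A n -> (infimum 0%N A <= n)%N.
Proof.
move=> [n0 An0].
have exA : exists n, `[< A n >] by exists n0; apply/asboolP.
case: (ex_minnP exA) => a /asboolP Aa amin.
have lbA : infimums A a.
  split=> [n An|n]; first by rewrite leEnat; apply: amin; apply/asboolP.
  by apply.
have -> : infimum 0%N A = a.
  rewrite /infimum; case: ifPn => [/eqP A0|_]; first by move: Aa; rewrite A0.
  case: xgetP => [b _ lbb|/(_ a)//].
  exact: (is_subset1_infimums lbb lbA).
by split=> // n An; apply: amin; apply/asboolP.
Qed.

Lemma infimum_natE A n : A n -> (forall k, A k -> (n <= k)%N) -> infimum 0%N A = n.
Proof.
move=> An lb; have [|Ai le] := @infimum_nat A; first by exists n.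
by apply/eqP; rewrite eqn_leq le //=; apply: lb.
Qed.

Lemma supremum_nat A N : A !=set0 -> (forall n, A n -> (n <= N)%N) ->
  A (supremum 0%N A) /\ forall n, A n -> (n <= supremum 0%N A)%N.
Proof.
move=> [n0 An0] AN.
have exA : exists n, `[< A n >] by exists n0; apply/asboolP.
have [|a /asboolP Aa amax] := ex_maxnP exA (m := N).
  by move=> n /asboolP /AN.
have lbA : supremums A a.
  split=> [n An|n]; first by rewrite leEnat; apply: amax; apply/asboolP.
  by apply.
have -> : supremum 0%N A = a.
  rewrite /supremum; case: ifPn => [/eqP A0|_]; first by move: Aa; rewrite A0.
  case: xgetP => [b _ lbb|/(_ a)//].
  exact: (is_subset1_supremums lbb lbA).
by split=> // n An; apply: amax; apply/asboolP.
Qed.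

Lemma supremum_nat_unbounded A : (forall N, exists2 n, A n & (N < n)%N) ->
  supremum 0%N A = 0%N.
Proof.
move=> unb; apply: supremum_out => -[_ [N ubN]].
have [n /ubN] := unb N; rewrite leEnat; lia.
Qed.

End Extrema.

(** * Minimal generators in local rings *)

Section Local.
Context {R : comNzRingType}.
Add Ring ring10 : (ring_axioms R).
Implicit Types (I J K B P Q : set R) (s v w : seq R) (x y z u : R) (c : nat -> R).
Variable m : set R.
Hypotheses (noeth : noetherian R) (loc : local_ring m).

Let maxm : [/\ ideal m, ~ m 1 & forall J, ideal J -> ~ J 1 -> m `<=` J -> J = m].
Proof. by apply/maxidealP; case: loc. Qed.

Lemma local_ideal : ideal m. Proof. by case: maxm. Qed.
Lemma local_proper : ~ m 1. Proof. by case: maxm. Qed.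
Let idm := local_ideal.
Let m1 := local_proper.

Lemma local_unit x : ~ m x -> exists y, x * y = 1.
Proof.
move=> nmx; apply: contrapT => nux.
have [||I [idI I1 Ix] maxI] := @noetherian_max _
    [set I | [/\ ideal I, ~ I 1 & I x]] noeth.
- by move=> I [].
- exists (gen [:: x]); split=> //; last by apply: gen_in; rewrite mem_head.
  move=> /gen_cons_inP[r [v [+ E]]]; rewrite gen_nil => v0; apply: nux; exists r.
  by rewrite E v0 addr0 mulrC.
apply: nmx; suff <- : I = m by [].
apply: loc.2; apply/maxidealP; split=> // J idJ J1 IJ.
apply/seteqP; split=> //; apply: maxI => //; split=> //; exact: IJ.
Qed.

Lemma local_in_jacobson : in_jacobson m.
Proof.
split=> // x mx; apply: local_unit => m1x; apply: m1.
by apply: (idealDr idm mx).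
Qed.
Let jm := local_in_jacobson.

Lemma proper_sub_local I : ideal I -> ~ I 1 -> I `<=` m.
Proof.
move=> idI I1 x Ix; apply: contrapT => /local_unit[y xy]; apply: I1.
by rewrite -xy; apply: (idealMr idI).
Qed.

Lemma local_prime : prime_ideal m.
Proof.
apply/primeP; split=> // x y mxy; have [|nmx] := pselect (m x); [by left|right].
have [z xz] := local_unit nmx.
have -> : y = z * (x * y) by rewrite mulrA [z * x]mulrC xz mul1r.
exact: (idealM idm).
Qed.

Lemma mu_gens I : ideal I -> exists2 s, gen s = I & size s = mu I.
Proof.
move=> idI; have [s sI] := noeth idI.
have [|[t /= tI szt] _] := @infimum_nat [set size s | s in [set s | gen s = I]].
  by exists (size s), s.
by exists t.
Qed.

Lemma mu_le I s : gen s = I -> (mu I <= size s)%N.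
Proof.
move=> sI; have [|_] := @infimum_nat [set size s | s in [set s | gen s = I]].
  by exists (size s), s.
by apply; exists s.
Qed.

Definition del_nth j s := take j s ++ drop j.+1 s.

Lemma size_del_nth j s : (j < size s)%N -> size (del_nth j s) = (size s).-1.
Proof. by move=> ltj; rewrite size_cat size_takel ?size_drop; lia. Qed.

Lemma del_nth_cat j s : (j < size s)%N -> s = take j s ++ s`_j :: drop j.+1 s.
Proof. by move=> ltj; rewrite -drop_nth // cat_take_drop. Qed.

Lemma redundant_generator K c s j : ideal K -> (j < size s)%N -> ~ m (c j) ->
  K (lincomb c s) -> gen s `<=` ideal_add (gen (del_nth j s)) K.
Proof.
move=> idK ltj /local_unit[y cy] Kc.
have ids : ideal (ideal_add (gen (del_nth j s)) K) by apply: ideal_add_ideal.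
apply: gen_sub => // x; rewrite {1}(del_nth_cat ltj) mem_cat in_cons => xs.
have [xd|nxd] := boolP (x \in del_nth j s).
  by exists x, 0; rewrite addr0; split; [exact: gen_in|exact: (ideal0 idK)|].
have {xs}xE : x = s`_j.
  move: xs nxd; rewrite /del_nth mem_cat => /or3P[->//|/eqP//|->]; by rewrite orbT.
pose c' i := c (i + (j <= i))%N.
have E : lincomb c s = lincomb c' (del_nth j s) + c j * s`_j.
  rewrite {1}(del_nth_cat ltj) /del_nth !lincomb_cat lincomb_cons size_takel ?(ltnW ltj) //= addn0.
  rewrite [lincomb c' (take j s)](_ : _ = lincomb c (take j s)); last first.
    apply: eq_lincomb => i; rewrite size_takel ?(ltnW ltj) // => lti.
    by rewrite /c' leqNgt lti addn0.
  rewrite [lincomb (fun i => c' _) _](_ : _ = lincomb ((fun i : nat => c (j + i)%N) \o S) (drop j.+1 s)); last first.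
    by apply: eq_lincomb => i _; rewrite /c' leq_addr /= addn1 addnS.
  by cring R.
exists (- y * lincomb c' (del_nth j s)), (y * lincomb c s); split.
- by apply: (idealM (ideal_ideal_gen _)); apply: gen_lincomb.
- exact: (idealM idK).
- rewrite xE -[LHS]mul1r -cy E; cring R.
Qed.

Lemma gen_del_nth c s j : (j < size s)%N -> ~ m (c j) ->
  ideal_mul m (gen s) (lincomb c s) -> gen s = gen (del_nth j s).
Proof.
move=> ltj mc Kc; apply/seteqP; split.
  apply: (nakayama jm) => //; exact: redundant_generator mc Kc.
apply: genS => x; rewrite /del_nth mem_cat => /orP[/mem_take//|/mem_drop//].
Qed.

Lemma mu_indep I s : gen s = I -> (size s <= mu I)%N -> indep m (ideal_mul m I) s.
Proof.
move=> sI szs c mc j ltj; apply: contrapT => nmc.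
rewrite -sI in mc; have /esym := gen_del_nth ltj nmc mc; rewrite sI => /mu_le.
by rewrite size_del_nth // ; lia.
Qed.

(** Take t as short as possible: a relation with a unit coefficient on an element
    of t would make this element redundant. *)
Lemma extend_to_generators I w : ideal I -> {in w, forall x, I x} ->
  indep m (ideal_mul m I) w ->
  exists t, gen (w ++ t) = I /\ indep m (ideal_mul m I) (w ++ t).
Proof.
move=> idI wI wi.
pose A := [set size t | t in [set t | gen (w ++ t) = I]].
have [|[t /= tI szt] tmin] := @infimum_nat A.
  have [s sI] := noeth idI; exists (size s), s => //=.
  apply/seteqP; split; last by rewrite -{1}sI; apply: genS => x xs; rewrite mem_cat xs orbT.
  apply: gen_sub => // x; rewrite mem_cat => /orP[/wI//|xs].
  by rewrite -sI; apply: gen_in.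
exists t; split=> // c mc.
have ct j : (j < size t)%N -> m (c (size w + j)%N).
  move=> ltj; apply: contrapT => nmc; rewrite -tI in mc.
  have ltj' : (size w + j < size (w ++ t))%N by rewrite size_cat ltn_add2l.
  have := gen_del_nth ltj' nmc mc; rewrite tI /del_nth take_cat drop_cat.
  rewrite ltnNge leq_addr /= addKn ltnNge -addnS leq_addr /= addKn -catA => /esym E.
  have : A (size (del_nth j t)) by exists (del_nth j t).
  by move=> /tmin; rewrite size_del_nth // -/A -szt; lia.
have mw : ideal_mul m I (lincomb c w).
  have mt : ideal_mul m I (lincomb (fun i => c (size w + i)%N) t).
    apply: lincomb_ideal_mul => // i lti; rewrite -tI; apply: gen_in.
    by rewrite mem_cat mem_nth ?orbT.
  by apply: (idealDr (ideal_mul_ideal _ _) mt); rewrite -lincomb_cat.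
move=> j; rewrite size_cat => ltj; have [ltjw|lewj] := ltnP j (size w); first exact: wi.
by rewrite -(subnKC lewj); apply: ct; lia.
Qed.

Lemma indep_le_mu I w : ideal I -> {in w, forall x, I x} ->
  indep m (ideal_mul m I) w -> (size w <= mu I)%N.
Proof.
move=> idI wI wi; have [t [tI ti]] := extend_to_generators idI wI wi.
have [s sI <-] := mu_gens idI.
apply: (leq_trans (n := size (w ++ t))); first by rewrite size_cat leq_addr.
by apply: (indep_size_le jm (ideal_mul_ideal m I)) => //; rewrite sI.
Qed.

Lemma basis_mu I s : ideal I -> gen s = I -> indep m (ideal_mul m I) s ->
  size s = mu I.
Proof.
move=> idI sI si; apply/eqP; rewrite eqn_leq mu_le // andbT.
by apply: indep_le_mu => // x xs; rewrite -sI; apply: gen_in.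
Qed.

(** * Systems of parameters *)

Lemma depth_ge_regular s B : {in s, forall x, m x} ->
  (forall i, (i < size s)%N -> nzd (ideal_addl B (take i s)) s`_i) -> depth_ge m B (size s).
Proof.
elim: s B => //= x s IHs B ms reg; exists x; split.
- by apply: ms; rewrite mem_head.
- exact: (reg 0%N).
- apply: IHs => [y ys|i lti]; first by apply: ms; rewrite in_cons ys orbT.
  exact: (reg i.+1).
Qed.

(** Let P contain the first i + 1 elements. The products t s_i^k with t outside P
    miss the ideal of the first i elements, modulo which s_i is regular; a prime
    over this ideal that avoids these products is contained in P and does not
    contain s_i. *)
Lemma prime_chain s : (forall i, (i < size s)%N -> nzd (gen (take i s)) s`_i) ->
  forall i P, (i <= size s)%N -> prime_ideal P -> gen (take i s) `<=` P ->
  exists J : nat -> set R, [/\ forall k, (k <= i)%N -> prime_ideal (J k),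
    forall k, (k < i)%N -> J k `<` J k.+1 & J i = P].
Proof.
move=> reg; elim=> [|i IHi] P lei prP sP.
  by exists (fun=> P); split.
have [idP P1 PM] : [/\ ideal P, ~ P 1 & forall x y, P (x * y) -> P x \/ P y] by apply/primeP.
pose T := [set u | exists t k, ~ P t /\ u = t * s`_i ^+ k].
have subt : gen (take i s) `<=` gen (take i.+1 s).
  by apply: genS => x; rewrite (take_nth 0) // mem_rcons in_cons => ->; rewrite orbT.
have [||||P' [prP' sP' TP']] := @exists_prime _ T (gen (take i s)) noeth.
- exact: ideal_ideal_gen.
- by exists 1, 0%N; rewrite expr0 mulr1.
- move=> _ _ [t [k [nt ->]]] [t' [k' [nt' ->]]]; exists (t * t'), (k + k')%N.
  by split; [move=> /PM[]|rewrite exprD; cring R].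
- move=> _ [t [k [nt ->]]]; rewrite mulrC => /(nzdX (reg i lei)) gt.
  by apply: nt; apply: sP; apply: subt.
have [J [prJ Jlt Ji]] := IHi P' (ltnW lei) prP' sP'.
exists (fun k => if (k <= i)%N then J k else P); split.
- by move=> k _; case: ifP => // /prJ.
- move=> k leki; have [->|ltki] : k = i \/ (k < i)%N by lia.
    rewrite leqnn ltnn Ji; split.
      move=> u P'u; apply: contrapT => nPu; apply: (TP' u) => //.
      by exists u, 0%N; rewrite expr0 mulr1.
    move=> PP'; apply: (TP' s`_i); first by exists 1, 1%N; rewrite expr1 mul1r.
    apply: PP'; apply: sP; apply: gen_in.
    by rewrite (take_nth 0) // mem_rcons mem_head.
  by rewrite (ltnW ltki) ltki; apply: Jlt.
- by rewrite ltnn.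
Qed.

Lemma mons_consP x s i t : t \in mons (x :: s) i ->
  exists k t', [/\ (k <= i)%N, t' \in mons s (i - k) & t = x ^+ k * t'].
Proof.
elim: i t => [|i IHi] t.
  by rewrite mons0 inE => /eqP ->; exists 0%N, 1; rewrite mons0 mul1r mem_head.
rewrite mons_consS mem_cat => /orP[/mapP[z zm ->]|tm].
  have [k [t' [leki t'm ->]]] := IHi z zm; exists k.+1, t'.
  by rewrite exprS mulrA subSS.
by exists 0%N, t; rewrite subn0 mul1r.
Qed.

Lemma exp_sub_of_nilpotent s Z : ideal Z ->
  {in s, forall x, exists k, Z (x ^+ k)} -> exists b, ideal_exp (gen s) b `<=` Z.
Proof.
move=> idZ; elim: s => [_|x s IHs nil].
  exists 1%N; rewrite ideal_exp1 // gen_nil => _ ->; exact: (ideal0 idZ).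
have [|b sZ] := IHs; first by move=> y ys; apply: nil; rewrite in_cons ys orbT.
have [k xk] := nil x (mem_head _ _).
exists (k + b)%N; rewrite gen_mons; apply: gen_sub => // t /mons_consP[j [t' [lej t'm ->]]].
have [lekj|ltjk] := leqP k j.
  by rewrite -(subnKC lekj) exprD -mulrA; apply: (idealMr idZ).
apply: (idealM idZ); apply: sZ.
apply: (@ideal_exp_le _ (gen s) b (k + b - j)%N); [exact: ideal_ideal_gen|lia|].
by rewrite gen_mons; apply: gen_in.
Qed.

(** A supremum over unbounded chains is 0 by convention, and then the bound on
    [mu m] makes m generated by one element x. In this case a prime P other than m satisfies P = x P, so P = 0,
    and chains have length at most 1 after all. *)
Lemma chains_bounded : cohen_macaulay m -> (mu m <= krull_dim R + 1)%N ->
  forall n, chain_lengths (@prime_ideal R) n -> (n <= krull_dim R)%N.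
Proof.
move=> cm mum.
have ne : chain_lengths (@prime_ideal R) !=set0.
  by exists 0%N, (fun=> m); split=> // i _; apply: local_prime.
have [[N bN]|unb] := pselect (exists N, forall n, chain_lengths (@prime_ideal R) n -> (n <= N)%N).
  by have [_] := supremum_nat ne bN.
exfalso; apply: (unb); have [s sm szs] := mu_gens idm.
have d0 : krull_dim R = 0%N.
  apply: supremum_nat_unbounded => N; apply: contrapT => noN; apply: unb; exists N => n Cn.
  by rewrite leqNgt; apply/negP => ltN; apply: noN; exists n.
have [x mx] : exists x, m = gen [:: x].
  rewrite d0 -szs in mum; case: s mum sm {szs} => [|x [|//]] _ <-; last by exists x.
  exists 0; apply/seteqP; split; first by apply: genS.
  apply: gen_sub => // z; rewrite inE => /eqP ->; exact: (ideal0 (ideal_ideal_gen _)).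
have pr0 P : prime_ideal P -> P <> m -> P `<=` [set 0].
  move=> prP Pm; have /primeP[idP P1 PM] := prP.
  have Psub := proper_sub_local idP P1.
  apply: (nakayama_ideal noeth jm) => // p Pp.
  have := Psub p Pp; rewrite {1}mx => /gen_cons_inP[r [v []]]; rewrite gen_nil => -> E.
  rewrite addr0 in E; exists 0, p; split=> //; last by rewrite add0r.
  rewrite E in Pp *; have [Pr|Px] := PM _ _ Pp.
    by rewrite mulrC; apply: ideal_mul_in => //; rewrite mx; apply: gen_in; rewrite mem_head.
  case: Pm; apply/seteqP; split=> //; rewrite mx; apply: gen_sub => // z.
  by rewrite inE => /eqP ->.
exists 1%N => n [J [prJ Jlt]]; rewrite leqNgt; apply/negP => lt1n.
have Jm k : (k <= n)%N -> J k `<=` m.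
  by move=> /prJ /primeP[idJ J1 _]; apply: proper_sub_local.
have [|_] := Jlt 1%N; first by [].
have [J01 nJ01] := Jlt 0%N (ltnW lt1n).
have J1m : J 1%N <> m.
  move=> J1m; have [|_] := Jlt 1%N; first by [].
  by apply; rewrite J1m; apply: Jm.
have /pr0 J10 := prJ 1%N (ltnW lt1n).
case: nJ01 => u /(J10 J1m) ->; have /primeP[idJ _ _] := prJ 0%N isT.
exact: (ideal0 idJ).
Qed.

(** By [prime_chain], a prime over a regular sequence of length dim R ends a chain
    of that length, so it cannot be smaller than m. As m is the only prime over the
    sequence, its elements are nilpotent modulo it. *)
Lemma cohen_macaulay_parameters : cohen_macaulay m -> (mu m <= krull_dim R + 1)%N ->
  depth_ge m [set 0] (krull_dim R) /\
  exists (z : seq R) b, [/\ size z = krull_dim R, {in z, forall x, m x} & ideal_exp m b `<=` gen z].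
Proof.
move=> cm mum; have bnd := chains_bounded cm mum; set d := krull_dim R in bnd *.
pose A := [set size s | s in [set s : seq R | regular_seq s /\ [set` s] `<=` m]].
have A0 : A 0%N.
  exists [::] => //; split=> //; split=> // E.
  have : gen [::] (1 : R) by rewrite E.
  by rewrite gen_nil => /eqP; rewrite oner_eq0.
have [z [[_ regz] mz] szz] : A d.
  rewrite /d -cm /depth -/A; have [[N bN]|unb] := pselect (exists N, forall n, A n -> (n <= N)%N).
    by have [] := supremum_nat (ex_intro _ _ A0) bN.
  rewrite supremum_nat_unbounded // => N; apply: contrapT => noN; apply: unb; exists N => n Cn.
  by rewrite leqNgt; apply/negP => ltN; apply: noN; exists n.
have mz' : {in z, forall x, m x} by move=> x; apply: mz.
have reg i : (i < size z)%N -> nzd (gen (take i z)) z`_i by move=> lti a; apply: regz.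
split.
  by rewrite -szz; apply: depth_ge_regular => // i lti; rewrite ideal_addl0; apply: reg.
have onlym P : prime_ideal P -> gen z `<=` P -> P = m.
  move=> prP zP; apply: contrapT => Pm.
  have [|J [prJ Jlt Jd]] := prime_chain reg (leqnn _) prP; first by rewrite take_size.
  have /primeP[idP P1 PM] := prP.
  suff : (d.+1 <= d)%N by rewrite ltnn.
  apply: bnd; exists (fun k => if (k <= d)%N then J k else m); split.
    move=> k _; case: ifP => [|_]; last exact: local_prime.
    by rewrite -szz; apply: prJ.
  move=> k lekd; have [->|ltkd] : k = d \/ (k < d)%N by lia.
    rewrite leqnn ltnn -szz Jd; split; first exact: proper_sub_local.
    by move=> mP; apply: Pm; apply/seteqP; split=> //; apply: proper_sub_local.
  by rewrite (ltnW ltkd) ltkd; apply: Jlt; rewrite szz.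
have [g gm] := noeth idm.
have [|b] := @exp_sub_of_nilpotent g (gen z) (ideal_ideal_gen _); last first.
  by rewrite gm => sub; exists z, b.
move=> x xg; apply: contrapT => nox.
have [||||P [prP zP TP]] := @exists_prime _ [set u | exists k, u = x ^+ k] (gen z) noeth.
- exact: ideal_ideal_gen.
- by exists 0%N.
- by move=> _ _ [k ->] [k' ->]; exists (k + k')%N; rewrite exprD.
- by move=> _ [k ->] gxk; apply: nox; exists k.
apply: (TP x); first by exists 1%N.
by rewrite (onlym P) // -gm; apply: gen_in.
Qed.

(** With fewer than d generators, [regular_generators] would leave a nonzerodivisor
    z of m modulo (s), although z^b is in (s). *)
Lemma parameters_ge_depth s b d : depth_ge m [set 0] d -> {in s, forall x, m x} ->
  ideal_exp m b `<=` gen s -> (d <= size s)%N.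
Proof.
move=> dp ms mb; rewrite leqNgt; apply/negP => lts.
have dp' : depth_ge m [set 0] (size s + (d - size s)) by rewrite subnKC // ltnW.
have [|_ [_ _ _ _]] := regular_generators (b := b) noeth jm (@ideal_set0 R) ms _ dp'.
  by rewrite ideal_addl0.
rewrite ideal_addl0 -(prednK (n := d - size s)); last by rewrite subn_gt0.
move=> [z [mz nz _]]; apply: m1; apply: (gen_sub idm ms).
by apply: (nzdX (n := b) nz); rewrite mulr1; apply: mb; apply: ideal_exp_in.
Qed.

End Local.

(** * Lengths *)

Section Length.
Context {R : comNzRingType}.
Add Ring ring11 : (ring_axioms R).
Implicit Types (I J K B P Q : set R) (s : seq R) (x y u v : R) (c : nat -> R).
Variable m : set R.
Hypotheses (noeth : noetherian R) (loc : local_ring m).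
Let idm := local_ideal loc.
Let m1 := local_proper loc.
Let jm := local_in_jacobson noeth loc.

Definition ideals_over I : set (set R) := [set J | ideal J /\ I `<=` J].

(** Filtrations of R/I with L cyclic steps killed by m, some of which may be zero. *)
Fixpoint length_le I L : Prop :=
  if L is L'.+1 then exists I' u,
    [/\ ideal I', length_le I' L', I `<=` I', I' `<=` ideal_addp I u & forall r, m r -> I (r * u)]
  else I = setT.

(** Adding u to the terms of a chain over I gives a chain over I', in which at most
    one inclusion is no longer strict: the one where u enters the chain. *)
Lemma length_le_chain I L n : ideal I -> length_le I L -> chain_lengths (ideals_over I) n -> (n <= L)%N.
Proof.
elim: L I n => [|L IHL] I n idI /=.
  move=> -> [J [CJ lt]]; case: n CJ lt => // n CJ /(_ 0%N isT)[_ []] u _.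
  by have [_] := CJ 0%N isT; apply.
move=> [I' [u [idI' lenI' II' I'u mu]]] [J [CJ lt]].
have idJ k : (k <= n)%N -> ideal (J k) by move=> /CJ[].
have IJ k : (k <= n)%N -> I `<=` J k by move=> /CJ[].
pose K k := ideal_addp (J k) u.
have overK k : (k <= n)%N -> ideals_over I' (K k).
  move=> lek; split; first by apply: ideal_addp_ideal; apply: idJ.
  apply: (subset_trans I'u); apply: ideal_addp_min; [by apply: ideal_addp_ideal; apply: idJ| |].
    by apply: (subset_trans (IJ k lek)); apply: ideal_addp_sub.
  by apply: ideal_addp_in; apply: idJ.
have Kle k : (k < n)%N -> K k `<=` K k.+1.
  move=> ltk; have [sub _] := lt k ltk; apply: ideal_addp_min; first by apply: ideal_addp_ideal; apply: idJ.
    by apply: (subset_trans sub); apply: ideal_addp_sub.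
  by apply: ideal_addp_in; apply: idJ.
have Klt k : (k < n)%N -> J k u \/ ~ J k.+1 u -> K k `<` K k.+1.
  move=> ltk H; split; first exact: Kle.
  have [sub nsub] := lt k ltk => Kk; apply: nsub => v Jv.
  have /Kk[w [r [Jw vE]]] : K k.+1 v by apply: ideal_addp_sub.
  have idk := idJ k (ltnW ltk); case: H => [Ju|nJu].
    by rewrite vE; apply: (idealD idk) => //; apply: (idealM idk).
  have ru : J k.+1 (r * u).
    by apply: (idealDr (idJ _ ltk) (sub _ Jw)); rewrite addrC -vE.
  have [mr|/(local_unit noeth loc)[y ry]] := pselect (m r).
    by rewrite vE; apply: (idealD idk) => //; apply: (IJ k (ltnW ltk)); apply: mu.
  case: nJu; have -> : u = y * (r * u) by rewrite mulrA [y * r]mulrC ry mul1r.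
  exact: (idealM (idJ _ ltk)).
have Jmono k l : (k <= l)%N -> (l <= n)%N -> J k `<=` J l.
  move=> /subnKC <-; elim: (l - k)%N => [|j IHj]; first by rewrite addn0 => _ v.
  rewrite addnS => ltn; apply: (subset_trans (IHj (ltnW ltn))).
  by case: (lt _ ltn).
have [[k1 [ltk1 nJ J1]]|none] := pselect (exists k1, [/\ (k1 < n)%N, ~ J k1 u & J k1.+1 u]); last first.
  apply: leqW; apply: (IHL I' n idI' lenI'); exists K; split=> // k ltk.
  apply: Klt => //; have [|nJk] := pselect (J k u); [by left|right => Jk1].
  by apply: none; exists k.
case: n CJ lt idJ IJ overK Kle Klt Jmono ltk1 => // n CJ lt idJ IJ overK Kle Klt Jmono ltk1.
(* Leave out the term of index k1, which u makes equal to the next one. *)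
apply: (IHL I' n idI' lenI'); exists (fun k => if (k < k1)%N then K k else K k.+1); split.
  by move=> k lek; case: ifP => _; apply: overK => //; apply: leqW.
move=> k ltk.
have big l : (k1 < l)%N -> (l <= n.+1)%N -> J l u by move=> lt1 len; apply: (Jmono k1.+1 l).
have small l : (l <= k1)%N -> ~ J l u.
  by move=> le1 /(Jmono l k1 le1 (ltnW ltk1)).
have [ltk1'|] := ltnP k.+1 k1.
  by rewrite (ltnW ltk1'); apply: Klt; [lia|right; apply: small; apply: ltnW].
rewrite leq_eqVlt => /orP[/eqP k1E|ltk1''].
  have -> : (k < k1)%N by lia.
  have lt1 : K k `<` K k.+1 by apply: Klt; [lia|right; apply: small; lia].
  split; first by apply: (subset_trans lt1.1); apply: Kle; lia.
  by move=> sub; apply: lt1.2; apply: (subset_trans _ sub); apply: Kle; lia.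
have -> : (k < k1)%N = false by lia.
by apply: Klt; [lia|left; apply: big; lia].
Qed.

Lemma length_le_sub I I2 L : ideal I2 -> I `<=` I2 -> length_le I L -> length_le I2 L.
Proof.
elim: L I I2 => [|L IHL] I I2 idI2 sub /=.
  by move=> IT; apply/seteqP; split=> // u _; apply: sub; rewrite IT.
move=> [I' [u [idI' lenI' II' I'u mu]]].
pose I2' := ideal_add I2 I'.
have id2' : ideal I2' by apply: ideal_add_ideal.
exists I2', u; split=> //.
- apply: (IHL I') => // v I'v; exists 0, v; split=> //; [exact: (ideal0 idI2)|by rewrite add0r].
- move=> v I2v; exists v, 0; split=> //; [exact: (ideal0 idI')|by rewrite addr0].
- move=> _ [a [b [I2a /I'u[b' [r [Ib' ->]]] ->]]]; exists (a + b'), r; split; last by rewrite addrA.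
  by apply: (idealD idI2) => //; apply: sub.
- by move=> r mr; apply: sub; apply: mu.
Qed.

Lemma length_le_step K K' s M : ideal K -> ideal K' -> K `<=` K' ->
  {in s, forall x, K' x} -> K' `<=` ideal_addl K s -> ideal_mul m K' `<=` K ->
  length_le K' M -> length_le K (size s + M).
Proof.
elim: s K => [|x s IHs] K idK idK' KK' sK' /= K's mK' lenK'.
  by have -> : K = K' by apply/seteqP; split.
exists (ideal_addp K x), x; split=> //.
- exact: ideal_addp_ideal.
- apply: IHs => //.
  + exact: ideal_addp_ideal.
  + by apply: ideal_addp_min => //; apply: sK'; rewrite mem_head.
  + by move=> z zs; apply: sK'; rewrite in_cons zs orbT.
  + by apply: (subset_trans mK'); apply: ideal_addp_sub.
- exact: ideal_addp_sub.
- by move=> r mr; apply: mK'; apply: ideal_mul_in => //; apply: sK'; rewrite mem_head.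
Qed.

Lemma chain_step K K' s M : ideal K -> ideal K' -> K `<=` K' ->
  {in s, forall x, K' x} -> indep m K s ->
  chain_lengths (ideals_over K') M -> chain_lengths (ideals_over K) (size s + M)%N.
Proof.
move=> + idK' + + + CK'; elim: s K => [|x s IHs] K idK KK' sK' si.
  by have [J [CJ lt]] := CK'; exists J; split=> // i /CJ[idJ sub]; split=> //; apply: (subset_trans KK').
have nKx : ~ K x.
  move=> Kx; apply: m1; apply: (si (fun j => (j == 0%N)%:R) _ 0%N) => //.
  rewrite lincomb_cons mul1r [lincomb _ _](_ : _ = 0) ?addr0 // /lincomb big1 // => i _.
  by rewrite /= mul0r.
have [|||c Kc j ltj|J [CJ lt]] := IHs (ideal_addp K x).
- exact: ideal_addp_ideal.
- by apply: ideal_addp_min => //; apply: sK'; rewrite mem_head.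
- by move=> z zs; apply: sK'; rewrite in_cons zs orbT.
- have [b [r [Kb cE]]] := Kc.
  apply: (si (fun i => if i is i'.+1 then c i' else - r) _ j.+1) => //.
  rewrite lincomb_cons [lincomb _ _](_ : _ = lincomb c s) // cE; have -> : - r * x + (b + r * x) = b by cring R.
  by [].
exists (fun k => if k is k'.+1 then J k' else K); split.
  move=> [|k] lek; first by split.
  by have [idJ sub] := CJ k lek; split=> //; apply: (subset_trans _ sub); apply: ideal_addp_sub.
move=> [|k] ltk; last exact: lt.
have [idJ sub] := CJ 0%N isT; split; first by apply: (subset_trans _ sub); apply: ideal_addp_sub.
by move=> JK; apply: nKx; apply: JK; apply: sub; apply: ideal_addp_in.
Qed.

Lemma chain_setT : chain_lengths (ideals_over setT) 0.
Proof. by exists (fun=> setT); split. Qed.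

Lemma quotient_lengthE I L : ideal I -> length_le I L -> chain_lengths (ideals_over I) L ->
  quotient_length I = L.
Proof.
move=> idI lenI CL.
have bnd n : chain_lengths (ideals_over I) n -> (n <= L)%N by apply: length_le_chain.
have [|C ub] := @supremum_nat (chain_lengths (ideals_over I)) L _ bnd; first by exists L.
by apply/eqP; rewrite eqn_leq; apply/andP; split; [apply: bnd|apply: ub].
Qed.

Lemma length_le_power N : length_le (ideal_exp m N) (\sum_(i < N) mu (ideal_exp m i)).
Proof.
elim: N => [|N IHN]; first by rewrite big_ord0.
have [s sE sz] := mu_gens noeth (ideal_exp_ideal m N).
rewrite big_ord_recr /= addnC -sz; apply: (length_le_step (K' := ideal_exp m N)) => //.
- by apply: ideal_mul_subr.
- by move=> x xs; rewrite -sE; apply: gen_in.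
- move=> u; rewrite -{1}sE => gu; apply/ideal_addlP; exists 0, u.
  by rewrite add0r; split=> //; apply: (ideal0 (ideal_mul_ideal _ _)).
Qed.

Lemma chain_power N :
  chain_lengths (ideals_over (ideal_exp m N)) (\sum_(i < N) mu (ideal_exp m i))%N.
Proof.
elim: N => [|N IHN]; first by rewrite big_ord0; apply: chain_setT.
have [s sE sz] := mu_gens noeth (ideal_exp_ideal m N).
rewrite big_ord_recr /= addnC -sz; apply: (chain_step (K' := ideal_exp m N)) => //.
- by apply: ideal_mul_subr.
- by move=> x xs; rewrite -sE; apply: gen_in.
- by apply: (mu_indep noeth loc sE); rewrite sz.
Qed.

Lemma quotient_length_power N :
  quotient_length (ideal_exp m N) = (\sum_(i < N) mu (ideal_exp m i))%N.
Proof. by apply: quotient_lengthE; [|exact: length_le_power|exact: chain_power]. Qed.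

Lemma length_le_mul A K (w0 : R) L M : ideal A -> ideal K -> (forall a, A a -> K (w0 * a)) ->
  length_le A L -> length_le (ideal_addp K w0) M -> length_le K (L + M).
Proof.
elim: L A K => [|L IHL] A K idA idK wA /=.
  move=> AT; apply: length_le_sub => //; apply: ideal_addp_min => //.
  by rewrite -(mulr1 w0); apply: wA; rewrite AT.
move=> [A' [u [idA' lenA' AA' A'u mA]]] lenKw.
exists (ideal_addp K (w0 * u)), (w0 * u); split=> //.
- exact: ideal_addp_ideal.
- apply: (IHL A') => //; first exact: ideal_addp_ideal.
    move=> _ /A'u[b [r [Ab ->]]]; exists (w0 * b), r; split; [exact: wA|by cring R].
  apply: length_le_sub lenKw; first by apply: ideal_addp_ideal; apply: ideal_addp_ideal.
  apply: ideal_addp_min; first by apply: ideal_addp_ideal; apply: ideal_addp_ideal.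
    by move=> v Kv; apply: ideal_addp_sub; apply: ideal_addp_sub.
  by apply: ideal_addp_in; apply: ideal_addp_ideal.
- exact: ideal_addp_sub.
- by move=> r mr; rewrite mulrCA; apply: wA; apply: mA.
Qed.

Lemma length_le_list A L K ws M : ideal A -> length_le A L -> ideal K ->
  {in ws, forall w0, forall a, A a -> K (w0 * a)} ->
  length_le (ideal_addl K ws) M -> length_le K (size ws * L + M).
Proof.
move=> idA lenA; elim: ws K => [|w0 ws IHws] K idK wA //= lenK.
rewrite mulSn -addnA; apply: (length_le_mul (A := A) (w0 := w0)) => //.
  by apply: wA; rewrite mem_head.
apply: IHws => //; first exact: ideal_addp_ideal.
by move=> w1 w1s a Aa; apply: ideal_addp_sub; apply: wA => //; rewrite in_cons w1s orbT.
Qed.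

(** The quotient of two successive powers is generated by monomials, each of them
    annihilated by (z). *)
Lemma length_le_parameter_power z L N : length_le (gen z) L ->
  length_le (ideal_exp (gen z) N) (L * \sum_(i < N) nmons (size z) i).
Proof.
move=> lenz; elim: N => [|N IHN]; first by rewrite big_ord0 muln0.
rewrite big_ord_recr /= mulnDr addnC mulnC -size_mons.
apply: (length_le_list (A := gen z)) => //.
  move=> w0 wm a za; rewrite mulrC; apply: ideal_mul_in => //.
  by rewrite gen_mons; apply: gen_in.
rewrite -/(ideal_exp (gen z) N.+1); apply: length_le_sub IHN; first by apply: ideal_addl_ideal.
rewrite gen_mons => u gu; apply/ideal_addlP; exists 0, u; rewrite add0r; split=> //.
exact: (ideal0 (ideal_mul_ideal _ _)).
Qed.

End Length.

Lemma sum_nmons d N : (\sum_(i < N.+1) nmons d i)%N = nmons d.+1 N.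
Proof.
elim: N => [|N IHN]; first by rewrite big_ord_recr big_ord0 !nmons0.
by rewrite big_ord_recr IHN nmonsS.
Qed.

Section Relation.
Context {R : comNzRingType}.
Variable m : set R.
Hypotheses (noeth : noetherian R) (loc : local_ring m).

(** If there were no relation, the length of R/m^N would be a binomial coefficient
    of degree d + 1 in N, where d = size z. But it is at most the length of
    R/(z)^N, which has degree at most d. *)
Lemma exists_relation (g z : seq R) b : m = gen g -> size g = (size z).+1 ->
  {in z, forall x, m x} -> ideal_exp m b `<=` gen z ->
  exists i, ~ indep m (ideal_exp m i.+1) (mons g i).
Proof.
move=> mE szg mz bz; apply: contrapT => no.
have idm := local_ideal loc.
have ind i : indep m (ideal_exp m i.+1) (mons g i).
  by apply: contrapT => ni; apply: no; exists i.
have muE i : mu (ideal_exp m i) = nmons (size z).+1 i.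
  rewrite -szg -size_mons; apply/esym; apply: (basis_mu noeth loc) => //; last exact: ind.
  by rewrite mE gen_mons.
have lenz := length_le_sub (ideal_ideal_gen _) bz (length_le_power m noeth b).
set L := (\sum_(i < b) _)%N in lenz.
have le N : (nmons (size z).+2 N <= L * nmons (size z).+1 N)%N.
  rewrite -!sum_nmons; have lenzN := length_le_parameter_power N.+1 lenz.
  apply: (length_le_chain noeth loc _ lenzN); first exact: ideal_exp_ideal.
  have := chain_power noeth loc N.+1; under eq_bigr do rewrite muE.
  case=> J [CJ lt]; exists J; split=> // i /CJ[idJ sub]; split=> //.
  apply: (subset_trans _ sub); apply: ideal_exp_sub.
  exact: gen_sub.
set d := size z in le.
(* (d + 1) C(N + d + 1, d + 1) = (N + d + 1) C(N + d, d) *)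
have := le (d.+1 * L)%N; rewrite !nmons_bin addnS -(leq_pmul2l (ltn0Sn d)).
rewrite -mul_bin_diag /= mulnA leq_pmul2r ?bin_gt0 ?leq_addl //.
by rewrite -addSn ltnNge leq_addr.
Qed.

End Relation.

(** * The Hilbert-Samuel polynomial *)

Section HilbertPolynomial.
Local Opaque nmons.

(** The sum over j < f of the binomial coefficients (N - 1 - j + d choose d). *)
Definition hilbert_poly (d f : nat) : {poly rat} :=
  (d`!)%:R^-1 *: \sum_(j < f) \prod_(i < d) ('X - (j.+1%:R + i%:R - d%:R)%:P).

Lemma hilbert_poly_eval d f N : (f <= N)%N ->
  (hilbert_poly d f).[N%:R] = (\sum_(j < f) nmons d.+1 (N - j.+1))%N%:R.
Proof.
move=> lefN; rewrite hornerZ horner_sum natr_sum mulr_sumr; apply: eq_bigr => j _.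
have ltj := leq_trans (ltn_ord j) lefN.
rewrite horner_prod nmons_bin; set n := (N - j.+1 + d)%N.
rewrite (eq_bigr (fun i : 'I_d => (n - i)%:R)) => [|i _].
  rewrite -natr_prod -ffact_prod -bin_ffact natrM mulrCA mulVf ?mulr1 //.
  by rewrite pnatr_eq0 -lt0n fact_gt0.
rewrite !hornerE natrB; last by have := ltn_ord i; rewrite /n; lia.
by rewrite /n natrD natrB // !opprD opprK !addrA addrAC.
Qed.

Lemma hilbert_poly_coef d f : (d`!)%:R * (hilbert_poly d f)`_d = f%:R.
Proof.
rewrite coefZ mulrA divff ?mul1r; last by rewrite pnatr_eq0 -lt0n fact_gt0.
rewrite coef_sum (eq_bigr (fun=> 1)) ?sumr_const ?card_ord // => j _.
rewrite -(big_map (fun i : 'I_d => (j.+1%:R + i%:R - d%:R : rat)) predT (fun a => 'X - a%:P)).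
set s := map _ _.
have szs : size s = d by rewrite -sum1_size big_map sum_nat_const card_ord muln1.
have := monicP (monic_prod_XsubC s predT id); rewrite lead_coefE.
by rewrite size_prod_XsubC szs.
Qed.

Lemma eventually_equal_poly (p q : {poly rat}) N :
  (forall n, (N <= n)%N -> p.[n%:R] = q.[n%:R]) -> p = q.
Proof.
move=> pq; apply/eqP; rewrite -subr_eq0; apply/eqP.
apply: (@roots_geq_poly_eq0 _ _ [seq (N + i)%:R | i <- iota 0 (size (p - q))]).
- apply/allP => _ /mapP[i _ ->]; rewrite rootE !hornerE pq ?leq_addr //.
  by rewrite subrr.
- rewrite map_inj_uniq ?iota_uniq // => a b /eqP; rewrite eqr_nat eqn_add2l.
  by move/eqP.
- by rewrite size_map size_iota.
Qed.

Lemma multiplicity_eq (R : comNzRingType) (m : set R) f :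
  noetherian R -> local_ring m ->
  (forall i, mu (ideal_exp m i) =
     (\sum_(j < f | (j <= i)%N) nmons (krull_dim R) (i - j))%N) ->
  multiplicity m = f%:R.
Proof.
move=> noeth loc muE; set d := krull_dim R in muE.
have lenE n : (f <= n)%N ->
    (hilbert_poly d f).[n%:R] = (quotient_length (ideal_exp m n))%:R.
  move=> lefn; rewrite hilbert_poly_eval // (quotient_length_power noeth loc); congr (_%:R).
  under [RHS]eq_bigr do rewrite muE big_mkcond.
  rewrite exchange_big; apply: eq_bigr => j _.
  have ltj := leq_trans (ltn_ord j) lefn.
  rewrite -sum_nmons -big_mkcond.
  rewrite -(big_mkord (fun i => (j <= i)%N) (fun i => nmons d (i - j))) (big_cat_nat (n := j)) //=; last exact: ltnW.
  rewrite [X in _ = (X + _)%N](_ : _ = 0%N) ?add0n; last first.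
    by rewrite big_nat_cond big1 // => i H; exfalso; lia.
  rewrite -[X in (\sum_(X <= _ < _ | _) _)%N]add0n big_addn.
  under [RHS]eq_bigl do rewrite leq_addl.
  rewrite big_mkord.
  have -> : (n - j = (n - j.+1).+1)%N by lia.
  by apply: eq_bigr => i _; rewrite addnK.
rewrite /multiplicity -/d /hilbert_samuel_poly.
case: xgetP => [p _ [N pN]|none].
  have -> : p = hilbert_poly d f; last exact: hilbert_poly_coef.
  apply: (eventually_equal_poly (N := maxn N f)) => n; rewrite geq_max => /andP[leN lef].
  by rewrite pN // lenE.
by case: (none (hilbert_poly d f)); exists f => n /lenE.
Qed.

End HilbertPolynomial.

(** * Quadratic forms and ideals between m^2 and m *)

Section Quadrics.
Context {R : comNzRingType}.
Add Ring ring12 : (ring_axioms R).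
Implicit Types (s g : seq R) (c : nat -> R).
Variable m : set R.
Hypotheses (noeth : noetherian R) (loc : local_ring m).
Let idm := local_ideal loc.
Let m1 := local_proper loc.
Let jm := local_in_jacobson noeth loc.

Lemma lincomb_mons2 c x s : lincomb c (mons (x :: s) 2) =
  x * (c 0%N * x + lincomb (c \o S) s) + lincomb (fun i => c ((size s).+1 + i)%N) (mons s 2).
Proof. by rewrite mons_consS lincomb_cat lincomb_map size_map mons1 lincomb_cons. Qed.

(** A quadratic form that vanishes at all e_i and e_i + e_j is zero. *)
Lemma quadric_point n c k : (k < nmons n 2)%N -> ~ m (c k) ->
  exists (a : seq R) l, [/\ size a = n, (l < n)%N, a`_l = 1 & ~ m (lincomb c (mons a 2))].
Proof.
elim: n c k => [|n IHn] c k ltk mck; first by [].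
have [[k' [ltk' mck']]|no] :=
    pselect (exists k', (k' < nmons n 2)%N /\ ~ m (c (n.+1 + k')%N)).
  have [a [l [sza ltl al ma]]] := IHn (fun i => c (n.+1 + i)%N) k' ltk' mck'.
  exists (0 :: a), l.+1; split=> //=; first by rewrite sza.
  by rewrite -/(mons (0 :: a) 2) lincomb_mons2 mul0r add0r sza.
have mtail (a : seq R) : size a = n -> m (lincomb (fun i => c (n.+1 + i)%N) (mons a 2)).
  move=> sza; apply: lincomb_ideal_coef => // i; rewrite size_mons sza => lti.
  by apply: contrapT => nm; apply: no; exists i.
have [mc0|nmc0] := pselect (m (c 0%N)); last first.
  exists (1 :: nseq n 0), 0%N; split=> //; first by rewrite /= size_nseq.
  rewrite lincomb_mons2 size_nseq => /(idealDr idm (mtail _ (size_nseq n 0))).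
  rewrite mulr1 mul1r [lincomb _ _](_ : _ = 0) ?addr0 // /lincomb big1 // => i _.
  by rewrite nth_nseq if_same mulr0.
have k0 : (0 < k)%N by rewrite lt0n; apply/eqP => k0; apply: mck; rewrite k0.
have lekn : (k <= n)%N.
  rewrite leqNgt; apply/negP => ltnk; apply: no; exists (k - n.+1)%N.
  rewrite subnKC //; split=> //; rewrite -(ltn_add2r n.+1) subnK //.
  by move: ltk; rewrite nmonsS nmons1 addnC.
have lepn : (k.-1 < n)%N by rewrite prednK.
pose a := mkseq (fun j => (j == k.-1)%:R : R) n.
have sza : size a = n by rewrite size_mkseq.
exists (1 :: a), 0%N; split=> //=; first by rewrite sza.
rewrite -/(mons (1 :: a) 2) lincomb_mons2 sza => /(idealDr idm (mtail a sza)).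
rewrite mulr1 mul1r addrC => /(idealDr idm mc0).
have -> : lincomb (c \o S) a = c k.
  rewrite /lincomb sza (bigD1 (Ordinal lepn)) //= nth_mkseq // eqxx mulr1 prednK //.
  rewrite big1 ?addr0 // => i; rewrite -val_eqE /= => ne.
  by rewrite nth_mkseq // (negPf ne) mulr0.
by [].
Qed.

(** For [mu_over_square], where independence of quadratic monomials is to be used
    on a combination of squares. *)
Lemma squares_in_mons c s : exists c', lincomb c [seq x * x | x <- s] = lincomb c' (mons s 2) /\
  forall j, (j < size s)%N -> exists2 k, (k < nmons (size s) 2)%N & c' k = c j.
Proof.
elim: s c => [|x s IHs] c; first by exists c; split.
have [c1 [c1E c1P]] := IHs (c \o S).
exists (fun i => if i is 0 then c 0%N else if (i <= size s)%N then 0 else c1 (i - (size s).+1)%N).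
have nE : nmons (size s).+1 2 = ((size s).+1 + nmons (size s) 2)%N.
  by rewrite nmonsS nmons1.
split.
  rewrite lincomb_mons2 /= lincomb_cons c1E; congr (_ + _); last first.
    by apply: eq_lincomb => i _; rewrite addSn ltnNge leq_addr /= subSS addKn.
  rewrite [lincomb _ s](_ : _ = 0); first by cring R.
  by rewrite /lincomb big1 // => i _; rewrite /= ltn_ord mul0r.
move=> [_|j ltj]; first by exists 0%N => //; rewrite [size _]/= nE.
have [k ltk kE] := c1P j ltj; exists ((size s).+1 + k)%N; first by rewrite [size (_ :: _)]/= nE ltn_add2l.
by rewrite addSn ltnNge leq_addr /= subSS addKn.
Qed.

Lemma mons2_cat (x y : seq R) : exists A, mons (x ++ y) 2 = A ++ mons y 2 /\
  ideal_mul (gen x) (gen (x ++ y)) `<=` gen A.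
Proof.
elim: x => [|a x [A [AE Asub]]].
  exists [::]; split=> //; rewrite !gen_nil; apply: ideal_mul_sub => // u v -> _.
  by rewrite mul0r.
pose S := [seq a * t | t <- a :: (x ++ y)] ++ A; exists S; split.
  by rewrite cat_cons mons_consS mons1 AE catA.
have memS t : t \in a :: (x ++ y) -> a * t \in S by move=> ty; rewrite mem_cat map_f.
rewrite gen_mul; apply: gen_subl => _ /allpairsP[[u v] /= [ux vy ->]].
move: ux; rewrite in_cons => /orP[/eqP ->|ux].
  by apply: gen_in; apply: memS.
move: vy; rewrite in_cons => /orP[/eqP ->|vy].
  by apply: gen_in; rewrite mulrC; apply: memS; rewrite in_cons mem_cat ux orbT.
have : gen A (u * v) by apply: Asub; apply: ideal_mul_in; apply: gen_in.
by apply: genS => t tA; rewrite mem_cat tA orbT.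
Qed.

(** Split minimal generators of m into x_i generating I modulo m^2 and others y_j.
    The x_i and y_j^2 are independent in I/mI: a relation has its x_i-coefficients
    in m because the x_i are independent modulo m^2, and m I is contained in
    m (x) + m^3, where no combination of the y_j^2 can fall unless its coefficients
    are in m. *)
Lemma mu_over_square I : mu (ideal_exp m 2) = nmons (mu m) 2 ->
  ideal I -> I `<=` m -> ideal_exp m 2 `<=` I -> (mu m <= mu I)%N.
Proof.
move=> mu2 idI Im m2I.
pose A := [set size x | x in [set x : seq R | {in x, forall t, I t} /\
  I `<=` ideal_add (gen x) (ideal_exp m 2)]].
have [|[x [xI Ix] szx] xmin] := @infimum_nat A.
  have [s sI] := noeth idI; exists (size s), s => //; split.
    by move=> t ts; rewrite -sI; apply: gen_in.
  move=> u; rewrite -{1}sI => gu; exists u, 0; rewrite addr0; split=> //.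
  exact: (ideal0 (ideal_exp_ideal _ _)).
have m2E : ideal_exp m 2 = ideal_mul m m by rewrite ideal_expS ideal_exp1.
have xi : indep m (ideal_mul m m) x.
  move=> c mc j ltj; apply: contrapT => nmc.
  have gs := redundant_generator noeth loc (ideal_mul_ideal _ _) ltj nmc mc.
  have : A (size (del_nth j x)).
    exists (del_nth j x) => //; split.
      by move=> t; rewrite /del_nth mem_cat => /orP[/mem_take|/mem_drop] /xI.
    move=> u /Ix[v [w [/gs[v1 [v2 [gv1 mv2 ->]]] mw ->]]]; exists v1, (v2 + w).
    rewrite addrA m2E; split=> //; apply: (idealD (ideal_mul_ideal _ _)) => //.
    by rewrite -m2E.
  by move=> /xmin; rewrite size_del_nth // -/A -szx; lia.
have [|t [tm ti]] := extend_to_generators noeth loc idm _ xi.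
  by move=> z zx; apply: Im; apply: xI.
have szt : size (x ++ t) = mu m by apply: (basis_mu noeth loc).
have m2i : indep m (ideal_exp m 3) (mons (x ++ t) 2).
  rewrite ideal_expS; apply: (mu_indep noeth loc); first by rewrite -gen_mons tm.
  by rewrite size_mons szt mu2.
have tmem z : z \in t -> m z by move=> zt; rewrite -tm; apply: gen_in; rewrite mem_cat zt orbT.
have sq z : z \in [seq y * y | y <- t] -> ideal_exp m 2 z.
  by move=> /mapP[y yt ->]; rewrite m2E; apply: ideal_mul_in; apply: tmem.
pose W := x ++ [seq y * y | y <- t].
rewrite -szt (_ : size (x ++ t) = size W); last by rewrite !size_cat size_map.
apply: (indep_le_mu noeth loc) => //.
  by move=> z; rewrite mem_cat => /orP[/xI//|/sq/m2I].
move=> c mc.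
have msq : ideal_exp m 2 (lincomb (fun i => c (size x + i)%N) [seq y * y | y <- t]).
  by apply: lincomb_ideal => // i lti; apply: sq; apply: mem_nth.
have mcx j : (j < size x)%N -> m (c j).
  apply: xi; rewrite -m2E; apply: (idealDr (ideal_exp_ideal _ _) msq); rewrite -lincomb_cat.
  by rewrite m2E; apply: (ideal_mulS (@subset_refl _ m) Im).
suff mct j : (j < size t)%N -> m (c (size x + j)%N).
  move=> j; rewrite size_cat size_map => ltj; have [/mcx//|lej] := ltnP j (size x).
  by rewrite -(subnKC lej); apply: mct; rewrite ltn_subLR.
have [c' [c'E c'P]] := squares_in_mons (fun i => c (size x + i)%N) t.
have [B [BE Bsub]] := mons2_cat x t.
move: mc; rewrite lincomb_cat c'E.
set u := lincomb c x; set v := lincomb c' _ => muv.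
have [b [w [gb mw vE]]] : ideal_add (gen B) (ideal_exp m 3) v.
  have sub : ideal_mul m (gen x) `<=` gen B by rewrite -{1}tm ideal_mulC.
  have : ideal_mul m I `<=` ideal_add (gen B) (ideal_exp m 3).
    have ids : ideal (ideal_add (gen B) (ideal_exp m 3)) by apply: ideal_add_ideal.
    apply: ideal_mul_sub => // p _ mp /Ix[q [q' [gq mq' ->]]]; exists (p * q), (p * q').
    split; [by apply: sub; apply: ideal_mul_in| |by rewrite mulrDr].
    by rewrite ideal_expS; apply: ideal_mul_in.
  move=> /(_ _ muv)[b [w [gb mw E]]].
  exists (b - u), w; split=> //; last by rewrite -[LHS](addKr u) E; cring R.
  apply: (idealB (ideal_ideal_gen _)) => //; apply: sub.
  by apply: lincomb_ideal_mul => // i _; apply: gen_nth.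
move: gb => /genP[e bE].
have : ideal_exp m 3 (lincomb (fun i => if (i < size B)%N then - e i else c' (i - size B)%N) (mons (x ++ t) 2)).
  rewrite BE lincomb_cat [X in X + _](_ : _ = - b); last first.
    rewrite bE -mulN1r -lincombZ; apply: eq_lincomb => i lti; rewrite lti; by rewrite mulN1r.
  rewrite [X in _ + X](_ : _ = v); last first.
    by apply: eq_lincomb => i _; rewrite ltnNge leq_addr /= addKn.
  have -> : - b + v = w by rewrite vE; cring R.
  by [].
move=> /m2i mall ltj; have [k ltk <-] := c'P j ltj.
have ltBk : (size B + k < size (mons (x ++ t) 2))%N.
  by rewrite BE size_cat ltn_add2l size_mons.
by have := mall _ ltBk; rewrite ltnNge leq_addr /= addKn.
Qed.

End Quadrics.

(** * The theorem *)

Theorem corollary3p6 (R : comNzRingType) (m : set R)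
    (noethR : noetherian R) (localR : local_ring m)
    (hypR : hypersurface m) (m2_neq0 : ideal_exp m 2 <> [set 0]) :
  cs m = mu m /\
  (multiplicity m <= 2 -> ms m = krull_dim R) /\
  (~ (multiplicity m <= 2) -> ms m = mu m).
Proof.
have [cm mum] := hypR.
have idm := local_ideal localR.
have jm := local_in_jacobson noethR localR.
have [depm [z [b [szz mz bz]]]] := cohen_macaulay_parameters noethR localR cm mum.
set d := krull_dim R in mum depm szz *.
have m2E : ideal_exp m 2 = ideal_mul m m by rewrite ideal_expS ideal_exp1.
have m2m : ideal_exp m 2 `<=` m by rewrite m2E; apply: ideal_mul_subl.
have ge_d I : ideal I -> I `<=` m -> ideal_exp m 2 `<=` I -> (d <= mu I)%N.
  move=> idI Im m2I; have [s sI <-] := mu_gens noethR idI.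
  apply: (parameters_ge_depth noethR localR (b := 2) depm); last by rewrite sI.
  by move=> x xs; apply: Im; rewrite -sI; apply: gen_in.
have sq_sub I : ideal I -> ideal_exp I 2 = ideal_exp m 2 -> ideal_exp m 2 `<=` I.
  by move=> idI <-; rewrite ideal_expS ideal_exp1 //; apply: ideal_mul_subl.
have cs_mu : (forall I, ideal I -> I `<=` m -> ideal_exp I 2 = ideal_exp m 2 ->
    (mu m <= mu I)%N) -> cs m = mu m.
  move=> H; apply: infimum_natE; first by exists m => //; split=> //; exact: subset_refl.
  by move=> _ [I [idI Im I2] <-]; apply: H.
have ms_mu n : (exists I, [/\ ideal I, I `<=` m, ideal_exp m 2 `<=` I & mu I = n]) ->
    (forall I, ideal I -> I `<=` m -> ideal_exp m 2 `<=` I -> (n <= mu I)%N) -> ms m = n.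
  move=> [I [idI Im m2I muI]] H; apply: infimum_natE; first by exists I.
  by move=> _ [J [idJ Jm m2J] <-]; apply: H.
have [g gm szg] := mu_gens noethR idm.
have [mud|mud] : mu m = d \/ mu m = d.+1.
  by have := ge_d m idm (@subset_refl _ m) m2m; lia.
  have msd : ms m = d by apply: ms_mu => //; exists m; split=> //; exact: subset_refl.
  split; last by rewrite mud.
  by apply: cs_mu => I idI Im I2; rewrite mud; apply: ge_d => //; apply: sq_sub.
(* f is the order that an equation of R in a regular ring would have. *)
have szgd : size g = d.+1 by rewrite szg.
have [f [nf fmin]] : exists f, ~ indep m (ideal_exp m f.+1) (mons g f) /\
    forall i, (i < f)%N -> indep m (ideal_exp m i.+1) (mons g i).
  have ex : exists i, `[< ~ indep m (ideal_exp m i.+1) (mons g i) >].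
    have [|i ni] := exists_relation noethR localR (esym gm) _ mz bz; first by rewrite szz.
    by exists i; apply/asboolP.
  case: (ex_minnP ex) => f /asboolP nf fmin; exists f; split=> // i ltif.
  apply: contrapT => ni; have := fmin i; rewrite leqNgt ltif => H.
  by have := H (introT (asboolP _) ni).
have f_gt1 : (1 < f)%N.
  case: f nf fmin => [|[|f]] // nf _; case: nf.
    move=> c; rewrite mons0 lincomb_cons lincomb_nil addr0 mulr1 ideal_exp1 // => mc [|j] //.
  by rewrite mons1 m2E; apply: (mu_indep noethR localR gm); rewrite szg.
have [c [k [rel ltk nmck]]] : exists c k, [/\ ideal_exp m f.+1 (lincomb c (mons g f)),
    (k < size (mons g f))%N & ~ m (c k)].
  apply: contrapT => no; apply: nf => c mc j ltj; apply: contrapT => nmc.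
  by apply: no; exists c, j.
have muE i : mu (ideal_exp m i) = (\sum_(j < f | (j <= i)%N) nmons d (i - j))%N.
  have [s sE sz] := mu_gens noethR (ideal_exp_ideal m i); rewrite -sz.
  apply: (hilbert_function noethR jm _ (esym gm) szgd depm (ltnW f_gt1) fmin rel ltk nmck sE).
    exact: local_unit.
  by rewrite ideal_expS; apply: (mu_indep noethR localR sE); rewrite sz.
have mult : multiplicity m = f%:R by apply: multiplicity_eq.
have mu2 : mu (ideal_exp m 2) = (nmons d 2 + d + (2 < f))%N.
  rewrite muE; case: f f_gt1 {nf fmin rel ltk c k nmck muE mult} => [|[|[|f]]] // _.
    by rewrite big_mkcond !big_ord_recr big_ord0 /= nmons1 addn0.
  rewrite big_mkcond !big_ord_recl /= nmons1 nmons0 big1 ?addn0 ?addnA // => i _.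
split.
  apply: cs_mu => I idI Im I2; rewrite leqNgt; apply/negP; rewrite mud ltnS => leI.
  have muI : mu I = d by apply/eqP; rewrite eqn_leq leI ge_d //; apply: sq_sub.
  have [s sI szs] := mu_gens noethR idI.
  have : (mu (ideal_exp m 2) <= nmons d 2)%N.
    by rewrite -muI -szs -size_mons; apply: mu_le; rewrite -gen_mons sI.
  rewrite mu2 => le2; have d0 : d = 0%N by lia.
  apply: m2_neq0; rewrite -I2 -sI; rewrite muI d0 in szs; rewrite (size0nil szs) gen_nil.
  apply/seteqP; split; last by move=> _ ->; apply: (ideal0 (ideal_exp_ideal _ _)).
  by rewrite ideal_expS; apply: ideal_mul_subl.
rewrite mult; split=> [fle2|/negP fgt2].
  have f2 : f = 2%N by apply/eqP; rewrite eqn_leq f_gt1 andbT -(ler_nat rat).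
  rewrite f2 in rel ltk f_gt1.
  rewrite size_mons szgd in ltk; have [a [l [sza ltl al Fa]]] := quadric_point localR ltk nmck.
  have [||xs [szxs mxs red]] :=
    point_reduction noethR jm (esym gm) _ _ al (isT : (0 < 2)%N) rel (local_unit noethR localR Fa).
  - by rewrite szgd.
  - by rewrite szgd.
  have xsm : gen xs `<=` m.
    by rewrite mxs; apply: genS => x xx; rewrite in_cons xx orbT.
  have m2xs : ideal_exp m 2 `<=` gen xs by apply: (subset_trans red); apply: ideal_mul_subl.
  apply: ms_mu => //; exists (gen xs); split=> //; apply/eqP.
  rewrite eqn_leq ge_d // andbT.
  have -> : d = size xs by rewrite szxs szgd.
  exact: mu_le.
have lt2f : (2 < f)%N by rewrite ltnNge -(ler_nat rat).
apply: ms_mu; first by exists m; split=> //; exact: subset_refl.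
move=> I idI Im m2I; apply: (mu_over_square noethR localR) => //.
by rewrite mu2 lt2f mud nmonsS nmons1; lia.
Qed.
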